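(* The Kähler–Einstein metric $g_K=(1,1,2,2,2,1,3,3,1,4)$ on $F(5)=\mathrm{SU}(5)/T^4$, in the order $(x_{12},x_{13},x_{14},x_{15},x_{23},x_{24},x_{25},x_{34},x_{35},x_{45})$, is $G$-non-degenerate and $G$-unstable, and its coindex is $3$.
   Context: $F(n)=\mathrm{SU}(n)/T^{n-1}$, where $T=T^{n-1}$ is the diagonal maximal torus with Lie algebra $\mathfrak{t}$; $G=\mathrm{SU}(n)$. Let $Q=-B$ be minus the Killing form of $\mathfrak{su}(n)$. There is a $Q$-orthogonal decomposition $\mathfrak{su}(n)=\mathfrak{t}\oplus\bigoplus_{1\le i<j\le n}\mathfrak{p}_{ij}$, where $\mathfrak{p}_{ij}$ is the 2-dimensional space of skew-Hermitian matrices whose only nonzero entries are in positions $(i,j)$ and $(j,i)$; the $\mathfrak{p}_{ij}$ are irreducible and pairwise inequivalent under $\mathrm{Ad}(T)$. Hence every $G$-invariant metric on $F(n)$ is determined by $g=\sum_{i<j}x_{ij}\,Q|_{\mathfrak{p}_{ij}}$ on $\mathfrak{p}=\bigoplus\mathfrak{p}_{ij}\cong T_oF(n)$ with $x_{ij}>0$, and is denoted by the tuple $(x_{ij})$ in lexicographic order. Stability notions. Let $\mathcal M_1^G$ be the manifold of unit-volume $G$-invariant metrics. A metric $g\in\mathcal M_1^G$ is Einstein ($\mathrm{Rc}(g)=\rho g$) iff it is a critical point of the scalar curvature functional $\mathrm{Sc}:\mathcal M_1^G\to\mathbb R$. Let $\mathrm{Sc}''_g$ be the Hessian at such $g$, restricted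 to the space $\mathcal{TT}_g^G$ of $G$-invariant traceless divergence-free symmetric 2-tensors (here equal to $T_g\mathcal M_1^G$, the $G$-invariant $g$-traceless symmetric 2-tensors). The Einstein metric $g$ is $G$-unstable if $\mathrm{Sc}''_g(T,T)>0$ for some $T\in\mathcal{TT}_g^G$, and $G$-non-degenerate if $\mathrm{Sc}''_g|_{\mathcal{TT}_g^G}$ is non-degenerate; its coindex is the maximal dimension of a subspace of $\mathcal{TT}_g^G$ on which $\mathrm{Sc}''_g$ is positive definite. For Einstein metrics not of unit volume, these notions refer to the unit-volume rescaling. *)

(* Defs.v *)
From HB Require Import structures.
From mathcomp Require Import all_boot all_order all_algebra.
From mathcomp Require Import all_classical all_reals all_analysis.
From mathcomp Require Import complex.

Set Implicit Arguments.
Unset Strict Implicit.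
Unset Printing Implicit Defensive.

Import Order.TTheory GRing.Theory Num.Theory.

Local Open Scope ring_scope.

(* The flag manifold F(n) = SU(n)/T, with T the diagonal maximal torus, su(n)
   as a space of complex matrices and p = T_o F(n) the skew-Hermitian matrices
   with zero diagonal. *)

(* The pairs i < j, 0-based. *)
Definition ordpair (n : nat) := {p : 'I_n * 'I_n | (p.1 < p.2)%N}.

(* x : invtensor R n stands for the G-invariant symmetric 2-tensor
   sum_(i<j) x_ij Q|p_ij; it is a metric when all x_ij > 0. *)
Notation invtensor R n := {ffun ordpair n -> R^o}.

Section LieAlgebra.
Variables (R : realType) (n : nat).
Local Notation M := 'M[R[i]]_n.
Local Notation I := (Complex (0 : R) 1).

Definition adj (X : M) : M := (map_mx (fun z : R[i] => conjc z) X)^T.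
Definition rscale (r : R) (X : M) : M := (r%:C)%C *: X.
Definition brk (X Y : M) : M := X *m Y - Y *m X.

Definition in_p (X : M) : Prop := adj X = - X /\ forall i, X i i = 0.
Definition torus (a : M) : Prop :=
  [/\ is_diag_mx a, a *m adj a = 1%:M & \det a = 1].

Definition proj_p (X : M) : M :=
  \matrix_(i, j) (if i == j then 0 else X i j).
Definition proj_t (X : M) : M :=
  \matrix_(i, j) (if i == j then X i j else 0).
Definition proj_ij (p : ordpair n) (X : M) : M :=
  \matrix_(i, j) (if ((i, j) == val p) || ((j, i) == val p) then X i j else 0).

(* A real basis of p, two vectors E_ij - E_ji and i(E_ij + E_ji) for each
   p_ij; it is orthogonal for every invariant metric. *)
Definition pidx := (ordpair n * bool)%type.
Definition pbasis (a : pidx) : M :=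
  let i := (val a.1).1 in let j := (val a.1).2 in
  if a.2 then I *: (delta_mx i j + delta_mx j i)
  else delta_mx i j - delta_mx j i.
Definition p_coord (a : pidx) (X : M) : R :=
  let z := X (val a.1).1 (val a.1).2 in
  if a.2 then complex.Im z else complex.Re z.

(* For k < n-1 the i(E_kk - E_(n-1,n-1)) form a real basis of t; the k-th
   coordinate of X in t is Im X_kk. *)
Definition tbasis (k : 'I_n) : M :=
  diag_mx (\row_j (I * ((j == k)%:R - (j.+1 == n)%:R))).

(* The trace of a real-linear endomorphism of su(n) = t + p. *)
Definition tr_su (f : M -> M) : R :=
  \sum_(k < n | (k.+1 < n)%N) complex.Im (f (tbasis k) k k)
  + \sum_(a : pidx) p_coord a (f (pbasis a)).

Definition killing (X Y : M) : R := tr_su (fun Z => brk X (brk Y Z)).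
Definition Q (X Y : M) : R := - killing X Y.

End LieAlgebra.

Section Curvature.
Variables (R : realType) (n : nat).
Local Notation M := 'M[R[i]]_n.
Implicit Types x T : invtensor R n.

Definition tform x (X Y : M) : R :=
  \sum_(p : ordpair n) (x p : R) * Q (proj_ij p X) (proj_ij p Y).

Definition is_metric x : Prop := forall p, 0 < (x p : R).

(* 2 x(U(X,Y), Z) = x([Z,X]_p, Y) + x(X, [Z,Y]_p) for all Z in p. *)
Definition Umap x (X Y : M) : M :=
  \sum_(a : pidx n)
    rscale ((tform x (proj_p (brk (pbasis R a) X)) Y
             + tform x X (proj_p (brk (pbasis R a) Y)))
            / (2 * tform x (pbasis R a) (pbasis R a))) (pbasis R a).

(* The Levi-Civita connection of x at the origin, as its Nomizu map
   p x p -> p. *)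
Definition LC x (X Y : M) : M := rscale (2^-1) (proj_p (brk X Y)) + Umap x X Y.

Definition riem x (X Y Z : M) : M :=
  LC x X (LC x Y Z) - LC x Y (LC x X Z)
  - LC x (proj_p (brk X Y)) Z - brk (proj_t (brk X Y)) Z.

Definition ric x (Y Z : M) : R :=
  \sum_(a : pidx n) tform x (riem x (pbasis R a) Y Z) (pbasis R a)
                    / tform x (pbasis R a) (pbasis R a).

Definition scal x : R :=
  \sum_(a : pidx n) ric x (pbasis R a) (pbasis R a)
                    / tform x (pbasis R a) (pbasis R a).

Definition einstein x : Prop :=
  exists rho : R, forall X Y : M, in_p X -> in_p Y ->
    ric x X Y = rho * tform x X Y.

(* A G-invariant almost complex structure J, orthogonal and parallel. *)
Definition kahler x : Prop :=
  exists J : M -> M,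
    [/\ forall X, in_p X -> in_p (J X),
        forall (r : R) X Y, in_p X -> in_p Y ->
          J (rscale r X + Y) = rscale r (J X) + J Y,
        forall X, in_p X -> J (J X) = - X
      & forall a X, torus a -> in_p X ->
          J (a *m X *m adj a) = a *m J X *m adj a]
    /\ (forall X Y, in_p X -> in_p Y ->
          tform x (J X) (J Y) = tform x X Y
          /\ LC x X (J Y) = J (LC x X Y)).

End Curvature.

Section Stability.
Variables (R : realType) (n : nat).
Implicit Types x T : invtensor R n.

Definition gram x : 'M[R]_#|{: pidx n}| :=
  \matrix_(a, b) tform x (pbasis R (enum_val a)) (pbasis R (enum_val b)).

(* v0 is the volume of the metric with all x_ij = 1; an invariant metric has
   constant volume density relative to that one. *)
Definition volume (v0 : R) x : R :=
  v0 * Num.sqrt (\det (gram x) / \det (gram [ffun=> 1])).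

Definition in_M1 (v0 : R) x : Prop := is_metric x /\ volume v0 x = 1.

Definition tensor_trace x T : R :=
  \sum_(a : pidx n) tform T (pbasis R a) (pbasis R a)
                    / tform x (pbasis R a) (pbasis R a).

(* The tangent space at x of the manifold of invariant metrics of volume
   equal to that of x; all invariant tensors on F(n) are divergence-free. *)
Definition in_TT x T : Prop := tensor_trace x T = 0.

(* T |-> x exp (x^-1 T); restricted to the x-traceless T, it is a global chart
   at x, with identity differential at 0, of the invariant metrics having the
   volume of x, since det (x exp (x^-1 T)) = det x * exp (tr_x T). *)
Definition metric_chart x T : invtensor R n :=
  [ffun p => (x p : R) * expR ((T p : R) / (x p : R))].

(* The Hessian at x of scal restricted to that manifold, read in the chart
   above. At a critical point it does not depend on the chart. *)
Definition scal_hess x S T : R :=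
  derive1 (fun s : R =>
    derive1 (fun t : R => scal (metric_chart x (s *: S + t *: T))) 0) 0.

(* A notion for unit-volume metrics applied to the unit-volume rescaling. *)
Definition at_unit_volume (v0 : R) (P : invtensor R n -> Prop) x : Prop :=
  exists c : R, [/\ 0 < c, in_M1 v0 (c *: x) & P (c *: x)].

Definition G_unstable x : Prop :=
  einstein x /\ exists2 T, in_TT x T & 0 < scal_hess x T T.

Definition G_nondegenerate x : Prop :=
  einstein x /\
  forall S, in_TT x S -> (forall T, in_TT x T -> scal_hess x S T = 0) -> S = 0.

Definition positive_on x (V : {vspace invtensor R n}) : Prop :=
  (forall T, T \in V -> in_TT x T)
  /\ (forall T, T \in V -> T != 0 -> 0 < scal_hess x T T).

Definition coindex_eq (k : nat) x : Prop :=
  [/\ einstein x, exists2 V, positive_on x V & \dim V = k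
    & forall V, positive_on x V -> (\dim V <= k)%N].

End Stability.

Definition lexpairs (n : nat) : seq (nat * nat) :=
  [seq (i, j) | i <- iota 0 n, j <- iota i.+1 (n - i.+1)].

Definition tensor_of_seq (R : realType) (n : nat) (s : seq R) : invtensor R n :=
  [ffun p : ordpair n =>
     s`_(index (nat_of_ord (val p).1, nat_of_ord (val p).2) (lexpairs n))].

Definition gK (R : realType) : invtensor R 5 :=
  tensor_of_seq 5 [:: 1; 1; 2; 2; 2; 1; 3; 3; 1; 4].

(* Main.v *)
From HB Require Import structures.
Require Import Defs.
From mathcomp Require Import all_boot all_order all_algebra.
From mathcomp Require Import all_classical all_reals all_analysis.
From mathcomp Require Import complex zify ring lra.

Set Implicit Arguments.
Unset Strict Implicit.
Unset Printing Implicit Defensive.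

Import Order.TTheory GRing.Theory Num.Theory.

Local Open Scope ring_scope.

(* Write m_ij = m_ji = x_ij. On p the Levi-Civita connection is
     LC(X,Y)_ij = sum_k (al_ikj X_ik Y_kj - al_jki Y_ik X_kj),
     al_ikj = (m_ij + m_kj - m_ik) / (2 m_ij),
   which is complex bilinear; hence the trace defining ric is a sum over the
   complex basis E_pq of p (x) C, and ric = (1/n) sum_(i<j) c_ij Q|p_ij with
     c_ij = 1 + sum_k (m_ij^2 - (m_ik - m_jk)^2) / (4 m_ik m_jk).
   Consequently
     scal = 1/2 sum_ij 1/m_ij - 1/(4n) sum_ijk m_ij / (m_ik m_jk),
   a sum of exponentials in the variables log m_ij, so that the Hessian is read
   off from the exponents. For gK one has m_ij = |h_i - h_j| with
   h = (0, 1, -1, 2, -2): then al_ikj vanishes as soon as h_j lies between h_i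
   and h_k, which makes J X_ij = i sgn(h_i - h_j) X_ij parallel, and
   c_ij = m_ij, which gives the Einstein equation. The Hessian at gK is a
   rational quadratic form in the ten logarithmic variations; its signature on
   the hyperplane of trace-free tensors is (3,6). *)

(** * Real and imaginary parts, real scalars *)

Section ComplexParts.
Variable R : realType.
Implicit Types (z w : R[i]) (r s : R).

Lemma Re_add z w : complex.Re (z + w) = complex.Re z + complex.Re w.
Proof. by case: z w => [? ?] []. Qed.

Lemma Im_add z w : complex.Im (z + w) = complex.Im z + complex.Im w.
Proof. by case: z w => [? ?] []. Qed.

Lemma Re_opp z : complex.Re (- z) = - complex.Re z.
Proof. by case: z. Qed.

Lemma Re_bigsum (I : Type) (s : seq I) (P : pred I) (F : I -> R[i]) :
  complex.Re (\sum_(i <- s | P i) F i) = \sum_(i <- s | P i) complex.Re (F i).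
Proof. exact: (big_morph _ Re_add). Qed.

Lemma Im_bigsum (I : Type) (s : seq I) (P : pred I) (F : I -> R[i]) :
  complex.Im (\sum_(i <- s | P i) F i) = \sum_(i <- s | P i) complex.Im (F i).
Proof. exact: (big_morph _ Im_add). Qed.

Lemma Re_rscale r z : complex.Re (r%:C%C * z) = r * complex.Re z.
Proof. by case: z => a b /=; rewrite mul0r subr0. Qed.

Lemma Re_conjc z : complex.Re (conjc z) = complex.Re z.
Proof. by case: z. Qed.

Lemma conj_rscale r z : conjc (r%:C%C * z) = r%:C%C * conjc z.
Proof. by case: z => a b /=; congr Complex; ring. Qed.

Lemma real_complexN r : ((- r)%:C = - r%:C)%C.
Proof. by congr Complex; rewrite /= oppr0. Qed.

Lemma real_complexD r s : ((r + s)%:C = r%:C + s%:C)%C.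
Proof. by congr Complex; rewrite /= addr0. Qed.

Lemma real_complexM r s : ((r * s)%:C = r%:C * s%:C)%C.
Proof. by congr Complex; rewrite /= ?mulr0 ?mul0r; ring. Qed.

Lemma real_complex0 : ((0 : R)%:C = 0)%C.
Proof. by []. Qed.

Lemma complex_parts z w : complex.Re z = complex.Re w ->
  complex.Im z = complex.Im w -> z = w.
Proof. by case: z w => [? ?] [? ?] /= -> ->. Qed.

End ComplexParts.

(** * Sums over the pairs i < j *)

Section OrderedPairs.
Variable n : nat.
Implicit Types p : ordpair n.

Lemma ordpair_neq p : (val p).1 != (val p).2.
Proof. by rewrite neq_ltn (valP p). Qed.

Lemma ordpair_ex (i j : 'I_n) : i != j ->
  exists p : ordpair n, val p = (i, j) \/ val p = (j, i).
Proof.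
rewrite neq_ltn => /orP[lt_ij|lt_ji].
  by exists (Sub (i, j) lt_ij); left.
by exists (Sub (j, i) lt_ji); right.
Qed.

Lemma sum_ordpair (V : nmodType) (F : 'I_n -> 'I_n -> V) :
  \sum_(p : ordpair n) F (val p).1 (val p).2
  = \sum_(i < n) \sum_(j < n | (i < j)%N) F i j.
Proof.
rewrite pair_big_dep /=.
rewrite (reindex_omap (fun p : ordpair n => val p) insub) /=; last first.
  by move=> p lt_p; rewrite insubT.
by apply: eq_bigl => p; rewrite (valP p) valK eqxx.
Qed.

(** In full double sums the indices can be relabelled freely, which is why most computations below
    pass through them. *)
Lemma sum_ordpair_sym (V : nmodType) (F : 'I_n -> 'I_n -> V) :
  (forall i j, F i j = F j i) -> (forall i, F i i = 0) ->
  \sum_i \sum_j F i j = (\sum_(p : ordpair n) F (val p).1 (val p).2) *+ 2.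
Proof.
move=> Fsym F0; rewrite sum_ordpair mulr2n.
have -> : \sum_i \sum_j F i j =
    \sum_(i < n) \sum_(j < n | (i < j)%N) F i j +
    \sum_(i < n) \sum_(j < n | (j < i)%N) F i j.
  rewrite -big_split /=; apply: eq_bigr => i _.
  rewrite (bigID (fun j : 'I_n => (i < j)%N)) /=; congr (_ + _).
  rewrite (bigD1 i) ?ltnn //= F0 add0r; apply: eq_bigl => j.
  by rewrite -leqNgt ltn_neqAle andbC.
congr (_ + _); rewrite [RHS](exchange_big_dep (fun _ : 'I_n => true)) //=.
by apply: eq_bigr => i _; apply: eq_bigr => j _.
Qed.

Lemma sum_pidx (V : nmodType) (F : pidx n -> V) :
  \sum_a F a = \sum_(p : ordpair n) (F (p, false) + F (p, true)).
Proof.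
rewrite (eq_bigr (fun a => F (a.1, a.2))); last by case.
rewrite -(pair_bigA _ (fun (p : ordpair n) (s : bool) => F (p, s))) /=.
by apply: eq_bigr => p _; rewrite big_bool /= addrC.
Qed.

End OrderedPairs.

(* The symmetric n x n array with zero diagonal whose upper entries are x. *)
Definition sx (R : realType) n (x : invtensor R n) (i j : 'I_n) : R :=
  if insub (i, j) is Some p then x p else
  if insub (j, i) is Some p then x p else 0.

Section SymmetricArray.
Variables (R : realType) (n : nat) (x : invtensor R n).

Lemma sxE (p : ordpair n) : sx x (val p).1 (val p).2 = x p.
Proof. by rewrite /sx -surjective_pairing valK. Qed.

Lemma sxC i j : sx x i j = sx x j i.
Proof.
rewrite /sx; case: insubP => [p lt_ij _|_]; case: insubP => [q lt_ji _|_] //.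
by move: (ltn_trans lt_ij lt_ji); rewrite /= ltnn.
Qed.

Lemma sxx i : sx x i i = 0.
Proof. by rewrite /sx insubN //= ltnn. Qed.

Lemma sxP (P : 'I_n -> 'I_n -> R -> Prop) :
  (forall i j r, P i j r -> P j i r) ->
  (forall p : ordpair n, P (val p).1 (val p).2 (x p)) ->
  forall i j, i != j -> P i j (sx x i j).
Proof.
move=> Psym Px i j /ordpair_ex[p]; have := Px p; rewrite -sxE.
by move=> + [] E; rewrite E //= sxC => /Psym.
Qed.

Lemma sx_gt0 i j : is_metric x -> i != j -> 0 < sx x i j.
Proof. by move=> x_gt0; apply: (sxP (P := fun _ _ r => 0 < r)). Qed.

End SymmetricArray.

(** * The Killing form on p *)

Section KillingForm.
Variables (R : realType) (n : nat).
Local Notation M := 'M[R[i]]_n.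
Implicit Types (X Y Z W : M) (a : pidx n) (p : ordpair n).

Lemma in_pP X : in_p X <->
  (forall i j, conjc (X i j) = - X j i) /\ (forall i, X i i = 0).
Proof.
split=> -[hX X0]; split=> //.
  by move=> i j; have /matrixP/(_ j i) := hX; rewrite !mxE.
by apply/matrixP => i j; rewrite !mxE hX.
Qed.

Lemma in_p_conj X i j : in_p X -> conjc (X i j) = - X j i.
Proof. by move=> /in_pP[]. Qed.

Lemma in_p_diag X i : in_p X -> X i i = 0.
Proof. by move=> /in_pP[]. Qed.

(* Pairing of the (i,j) and (j,i) entries; summed over all i and j, it is the
   trace form Re tr (X Y). *)
Definition redot X Y (i j : 'I_n) : R := complex.Re (X i j * Y j i).

Lemma redot_sym X Y i j : in_p X -> in_p Y -> redot X Y i j = redot X Y j i.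
Proof.
move=> pX pY; rewrite /redot -Re_conjc rmorphM /= !in_p_conj //.
by rewrite mulrNN.
Qed.

Lemma redotC X Y i j : redot X Y i j = redot Y X j i.
Proof. by rewrite /redot mulrC. Qed.

Lemma redot_diag X Y i : in_p X -> redot X Y i i = 0.
Proof. by move=> pX; rewrite /redot in_p_diag // mul0r. Qed.

Lemma in_p_ext X Y : in_p X -> in_p Y ->
  (forall p, X (val p).1 (val p).2 = Y (val p).1 (val p).2) -> X = Y.
Proof.
move=> pX pY eXY; apply/matrixP => i j; case: (eqVneq i j) => [->|].
  by rewrite !in_p_diag.
move=> /ordpair_ex[p]; have := eXY p; move=> + [] E; rewrite E //= => eji.
by apply: oppr_inj; rewrite -!in_p_conj // eji.
Qed.

Lemma in_p_sum (I : finType) (F : I -> M) :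
  (forall i, in_p (F i)) -> in_p (\sum_i F i).
Proof.
move=> pF; apply/in_pP; split=> [i j|i]; rewrite !summxE.
  rewrite rmorph_sum -sumrN /=; apply: eq_bigr => k _; exact: in_p_conj.
by apply: big1 => k _; apply: in_p_diag.
Qed.

Lemma in_p_rscale r X : in_p X -> in_p (rscale r X).
Proof.
move=> pX; apply/in_pP; split=> [i j|i]; rewrite !mxE.
  by rewrite conj_rscale in_p_conj // mulrN.
by rewrite in_p_diag // mulr0.
Qed.

Lemma in_p_pbasis a : in_p (pbasis R a).
Proof.
have i_j := ordpair_neq a.1; have j_i := i_j; rewrite eq_sym in j_i.
apply/in_pP; rewrite /pbasis; split=> [i j|i]; case: a.2; rewrite !mxE.
- by rewrite ![i == _]eq_sym ![j == _]eq_sym; do 4!case: (_ == _);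
    rewrite /=; congr Complex; rewrite /= ?mulr0n ?mulr1n; ring.
- by rewrite ![i == _]eq_sym ![j == _]eq_sym; do 4!case: (_ == _);
    rewrite /=; congr Complex; rewrite /= ?mulr0n ?mulr1n; ring.
- by case: (eqVneq i (val a.1).1) => [->|]; rewrite ?(negPf i_j) /= ?andbF;
    rewrite addr0 mulr0.
- by case: (eqVneq i (val a.1).1) => [->|]; rewrite ?(negPf i_j) /= ?andbF;
    rewrite subr0.
Qed.

Lemma in_p_proj_ij p X : in_p X -> in_p (proj_ij p X).
Proof.
move=> pX; apply/in_pP; split=> [i j|i]; rewrite !mxE.
  by rewrite orbC; case: ifP => _; rewrite ?oppr0 ?conjc0 ?in_p_conj.
by case: ifP => // _; apply: in_p_diag.
Qed.

Lemma in_p_proj_brk X Y : in_p X -> in_p Y -> in_p (proj_p (brk X Y)).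
Proof.
move=> pX pY; apply/in_pP; split=> [i j|i]; rewrite !mxE ?eqxx //.
rewrite eq_sym; case: eqP => _; first by rewrite conjc0 oppr0.
rewrite rmorphB !rmorph_sum /= opprB; congr (_ - _); apply: eq_bigr => k _.
  by rewrite rmorphM /= !in_p_conj // mulrNN mulrC.
by rewrite rmorphM /= !in_p_conj // mulrNN mulrC.
Qed.

(* The two real basis vectors of p_ij contribute to the trace of a
   complex-linear map as E_ij and E_ji do. *)
Lemma p_coord_trace (F : M -> M) p :
  (forall c X Y, F (c *: X + Y) = c *: F X + F Y) ->
  p_coord (p, false) (F (pbasis R (p, false)))
  + p_coord (p, true) (F (pbasis R (p, true)))
  = 2 * complex.Re (F (delta_mx (val p).1 (val p).2) (val p).1 (val p).2).
Proof.
move=> linF.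
have F0 : F 0 = 0.
  by have := linF (-1) 0 0; rewrite scaler0 addr0 scaleN1r addNr.
have FD X Y : F (X + Y) = F X + F Y by rewrite -[X]scale1r linF !scale1r.
have FZ c X : F (c *: X) = c *: F X by rewrite -[_ *: X]addr0 linF F0 addr0.
rewrite /p_coord /pbasis /= -scaleN1r FD !FZ FD !mxE.
by case: (F _ _ _) => a b; case: (F _ _ _) => c d /=; ring.
Qed.

Lemma mul_mx_deltaE X (p q i j : 'I_n) :
  (X *m delta_mx p q) i j = X i p *+ (j == q).
Proof.
rewrite !mxE (bigD1 p) //= mxE eqxx /= big1 ?addr0 => [|k /negPf kp].
  by case: (j == q); rewrite ?mulr1 ?mulr0.
by rewrite mxE kp mulr0.
Qed.

Lemma mul_delta_mxE X (p q i j : 'I_n) :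
  (delta_mx p q *m X) i j = X q j *+ (i == p).
Proof.
rewrite !mxE (bigD1 q) //= mxE eqxx andbT big1 ?addr0 => [|k /negPf kq].
  by case: (i == p); rewrite ?mul1r ?mul0r.
by rewrite mxE kq andbF mul0r.
Qed.

Lemma brk_linear_r X c Y Z : brk X (c *: Y + Z) = c *: brk X Y + brk X Z.
Proof.
rewrite /brk mulmxDr mulmxDl -scalemxAr -scalemxAl scalerBr.
by rewrite opprD addrACA.
Qed.

Lemma brk_linear_l X c Y Z : brk (c *: Y + Z) X = c *: brk Y X + brk Z X.
Proof.
rewrite /brk mulmxDr mulmxDl -scalemxAr -scalemxAl scalerBr.
by rewrite opprD addrACA.
Qed.

Lemma ad2_delta X Y p : in_p X -> in_p Y ->
  let i := (val p).1 in let j := (val p).2 in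
  complex.Re (brk X (brk Y (delta_mx i j)) i j)
  = \sum_k redot X Y i k + \sum_k redot X Y j k.
Proof.
move=> pX pY i j; have /negPf i_j : i != j by exact: ordpair_neq.
have brkYE (a b : 'I_n) : 
    brk Y (delta_mx i j) a b = Y a i *+ (b == j) - Y j b *+ (a == i).
  by rewrite /brk mxE [in X in _ + X]mxE mul_mx_deltaE mul_delta_mxE.
rewrite /brk -/(brk _ _) mxE [in X in _ + X]mxE Re_add Re_opp !mxE !Re_bigsum.
rewrite -sumrN; congr (_ + _); apply: eq_bigr => k _.
  rewrite brkYE eqxx mulr1n in_p_diag // mul0rn subr0; exact: erefl.
rewrite brkYE eqxx mulr1n (in_p_diag i) // mul0rn sub0r mulNr Re_opp opprK.
by rewrite redotC redot_sym // redotC /redot mulrC.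
Qed.

(** Bracketing with a diagonal matrix d multiplies the (k,l) entry by d_k - d_l up to sign. For
    [tbasis] and l != k this is i, or 2i when l is the last index, whence the extra 1. The factor 2
    comes from the symmetry in X and Y. *)
Lemma ad2_tbasis X Y (k : 'I_n) : in_p X -> in_p Y -> (k.+1 < n)%N ->
  complex.Im (brk X (brk Y (tbasis R k)) k k)
  = \sum_l redot X Y k l *+ (2 * (1 + (l.+1 == n))).
Proof.
move=> pX pY lt_k.
have -> : brk X (brk Y (tbasis R k)) k k = \sum_l Complex 0 1 *
    (1 - (l == k)%:R + (l.+1 == n)%:R) * (X k l * Y l k + Y k l * X l k).
  rewrite /brk /tbasis !mul_mx_diag !mul_diag_mx !mxE -sumrB.
  apply: eq_bigr => l _; rewrite !mxE eqxx (ltn_eqF lt_k) /=; ring.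
rewrite Im_bigsum; apply: eq_bigr => l _.
case: (eqVneq l k) => [->|_].
  by rewrite redot_diag // mul0rn !in_p_diag // !mul0r addr0 mulr0.
have -> : complex.Im (Complex 0 1 * (1 - false%:R + (l.+1 == n)%:R)
    * (X k l * Y l k + Y k l * X l k))
  = (1 + (l.+1 == n)%:R) * (redot X Y k l + redot Y X k l).
  rewrite /redot; case: (X k l * _) => a b; case: (Y k l * _) => c d.
  by case: (l.+1 == n); rewrite /= ?mulr0n ?mulr1n; ring.
rewrite [redot Y X k l]redotC (redot_sym l k pX pY).
by case: (l.+1 == n) => /=; ring.
Qed.

(** This is 2n Re tr (XY), assembled from the share 2 of t and the share 2(n-1) of p. *)
Lemma killingE X Y : in_p X -> in_p Y ->
  killing X Y = (\sum_i \sum_j redot X Y i j) *+ (2 * n).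
Proof.
move=> pX pY; rewrite /killing /tr_su.
set u := fun i => \sum_j redot X Y i j; set U := \sum_i u i.
(* For n = 0 the predecessor [n.-1] is 0 instead of -1; that case is settled by the empty sum. *)
have U0 : n = 0 -> U = 0 by move=> n0; apply: big1 => -[m lt_m]; lia.
have -> : \sum_(k < n | (k.+1 < n)%N)
    complex.Im (brk X (brk Y (tbasis R k)) k k) = U *+ 2.
  (* All rows but the last are summed directly; the extra weight on the last column supplies, by
     symmetry, the missing last row. *)
  rewrite (eq_bigr (fun k => u k *+ 2
    + \sum_(l < n | l.+1 == n) redot X Y k l *+ 2)); last first.
    move=> k lt_k; rewrite ad2_tbasis // /u -sumrMnl.
    rewrite [X in _ + X]big_mkcond -big_split /=; apply: eq_bigr => l _.
    by case: ifP => _; rewrite ?addr0 // -mulrnDr.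
  have lastE (k : 'I_n) : (k.+1 < n)%N = (k.+1 != n).
    by rewrite ltn_neqAle (ltn_ord k) andbT.
  rewrite big_split -[RHS]sumrMnl [RHS](bigID (fun k : 'I_n => (k.+1 < n)%N)).
  congr (_ + _); rewrite (exchange_big_dep (fun l : 'I_n => l.+1 == n)) //=.
  apply: eq_big => [l|l /eqP l_last]; first by rewrite lastE negbK.
  rewrite sumrMnl; congr (_ *+ 2); rewrite /u [RHS](bigD1 l) //=.
  rewrite redot_diag // add0r; apply: eq_big => [k|k _]; last exact: redot_sym.
  rewrite lastE l_last eqxx andbT; congr (~~ _).
  by apply/eqP/eqP => [k_last|->//]; apply/val_inj/succn_inj; rewrite k_last.
have -> : \sum_a p_coord a (brk X (brk Y (pbasis R a)))
    = U *+ (2 * n.-1).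
  rewrite sum_pidx.
  rewrite (eq_bigr (fun p : ordpair n => (u (val p).1 + u (val p).2) *+ 2)).
    rewrite sumrMnl.
    (* The factor [i != j] extends the summand by 0 to the diagonal, as [sum_ordpair_sym]
       requires. *)
    pose F i j := (u i + u j) *+ (i != j).
    rewrite (eq_bigr (fun p : ordpair n => F (val p).1 (val p).2)); last first.
      by move=> p _; rewrite /F ordpair_neq.
    rewrite -sum_ordpair_sym /F; last 2 first.
    - by move=> i j; rewrite addrC eq_sym.
    - by move=> i; rewrite eqxx.
    have sum_j i : \sum_j (u i + u j) *+ (i != j)
        = u i *+ n + \sum_j u j - (u i) *+ 2.
      apply: (addIr (u i *+ 2)); rewrite addrNK.
      have -> : u i *+ n = \sum_(j < n) u i by rewrite sumr_const card_ord.
      rewrite -big_split [RHS](bigD1 i) //= (bigD1 i) //= eqxx mulr0n add0r.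
      rewrite addrC.
      rewrite mulr2n; congr (_ + _); apply: eq_bigr => j.
      by rewrite eq_sym => ->; rewrite mulr1n.
    rewrite (eq_bigr _ (fun i _ => sum_j i)) sumrB big_split /=.
    rewrite sumr_const card_ord.
    rewrite !sumrMnl -/U; have [/U0->|n_gt0] := posnP n.
      by rewrite !mul0rn subr0 addr0.
    rewrite -mulrnDr -mulrnBr; first by congr (_ *+ _); lia.
    lia.
  move=> p _.
  have -> := p_coord_trace (F := fun Z => brk X (brk Y Z)) p.
    by rewrite ad2_delta // mulr_natl.
  by move=> c Z W; rewrite !brk_linear_r.
rewrite -mulrnDr; have [/U0->|n_gt0] := posnP n.
  by rewrite !mul0rn.
by congr (_ *+ _); lia.
Qed.

End KillingForm.

(** * Relabelling of triple sums *)

Section TripleSums.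
Variables (V : nmodType) (I : finType) (F : I -> I -> I -> V).

Lemma sum3_rot :
  \sum_i \sum_j \sum_k F i j k = \sum_i \sum_j \sum_k F j k i.
Proof.
by under eq_bigr do rewrite exchange_big /=; rewrite exchange_big.
Qed.

Lemma sum3_swap :
  \sum_i \sum_j \sum_k F i j k = \sum_i \sum_j \sum_k F j i k.
Proof. by rewrite exchange_big. Qed.

Lemma sum3_swap_r :
  \sum_i \sum_j \sum_k F i j k = \sum_i \sum_j \sum_k F i k j.
Proof. by apply: eq_bigr => i _; rewrite exchange_big. Qed.

Lemma eq_sum3 (G : I -> I -> I -> V) : (forall i j k, F i j k = G i j k) ->
  \sum_i \sum_j \sum_k F i j k = \sum_i \sum_j \sum_k G i j k.
Proof.
by move=> eFG; do 3!apply: eq_bigr => ? _; apply: eFG.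
Qed.

Lemma sum3D (G : I -> I -> I -> V) :
  \sum_i \sum_j \sum_k (F i j k + G i j k)
  = \sum_i \sum_j \sum_k F i j k + \sum_i \sum_j \sum_k G i j k.
Proof.
rewrite -big_split; apply: eq_bigr => i _; rewrite -big_split.
by apply: eq_bigr => j _; rewrite -big_split.
Qed.

End TripleSums.

Lemma sum3B (V : zmodType) (I : finType) (F G : I -> I -> I -> V) :
  \sum_i \sum_j \sum_k (F i j k - G i j k)
  = \sum_i \sum_j \sum_k F i j k - \sum_i \sum_j \sum_k G i j k.
Proof.
rewrite -sumrB; apply: eq_bigr => i _; rewrite -sumrB.
by apply: eq_bigr => j _; rewrite -sumrB.
Qed.

Lemma sum3_mulr (V : pzRingType) (I : finType) (F : I -> I -> I -> V) c :
  c * (\sum_i \sum_j \sum_k F i j k) = \sum_i \sum_j \sum_k c * F i j k.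
Proof.
rewrite mulr_sumr; apply: eq_bigr => i _; rewrite mulr_sumr.
by apply: eq_bigr => j _; rewrite mulr_sumr.
Qed.

(** * Invariant forms in the real basis of p *)

Section InvariantForms.
Variables (R : realType) (n : nat).
Local Notation M := 'M[R[i]]_n.
Implicit Types (x : invtensor R n) (X Y Z W E : M) (a b : pidx n).
Implicit Types (p q : ordpair n).

Lemma p_coordD a X Y : p_coord a (X + Y) = p_coord a X + p_coord a Y.
Proof. by rewrite /p_coord mxE Re_add Im_add; case: a.2. Qed.

Lemma p_coord0 a : p_coord a (0 : M) = 0.
Proof. by rewrite /p_coord mxE; case: a.2. Qed.

Lemma p_coord_rscale a r X : p_coord a (rscale r X) = r * p_coord a X.
Proof.
rewrite /p_coord mxE; case: a.2; last exact: Re_rscale.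
by case: (X _ _) => u v /=; rewrite mul0r addr0.
Qed.

Lemma p_coord_sum a (I : finType) (F : I -> M) :
  p_coord a (\sum_i F i) = \sum_i p_coord a (F i).
Proof. by rewrite (big_morph _ (p_coordD a) (p_coord0 a)). Qed.

Lemma delta_ordpair p q :
  (delta_mx (val p).1 (val p).2 : M) (val q).1 (val q).2 = (p == q)%:R.
Proof.
by rewrite mxE [p == q]eq_sym.
Qed.

Lemma delta_ordpairC p q :
  (delta_mx (val p).1 (val p).2 : M) (val q).2 (val q).1 = 0.
Proof.
rewrite mxE; case: eqP => [q2|//]; case: eqP => [q1|//].
by have := valP q; rewrite /= q1 q2 ltnNge ltnW ?(valP p).
Qed.

Lemma pbasis_entry a q : (pbasis R a : M) (val q).1 (val q).2
  = (if a.2 then Complex 0 1 else 1) *+ (a.1 == q).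
Proof.
have dE := delta_ordpair a.1 q; have dC := delta_ordpairC a.1 q.
rewrite mxE in dE; rewrite mxE andbC in dC.
rewrite /pbasis; case: a.2; rewrite !mxE dE dC; case: (a.1 == q) => /=.
- by rewrite addr0 mulr1 mulr1n.
- by rewrite addr0 mulr0.
- by rewrite subr0 mulr1n.
- by rewrite subr0.
Qed.

Lemma p_coord_pbasis a b : p_coord a (pbasis R b : M) = (a == b)%:R.
Proof.
have -> : (a == b) = (b.1 == a.1) && (b.2 == a.2) by rewrite eq_sym.
rewrite /p_coord !pbasis_entry.
by case: (b.1 == a.1); case: b.2; case: a.2.
Qed.

Lemma in_p_coord_ext X Y : in_p X -> in_p Y ->
  (forall a, p_coord a X = p_coord a Y) -> X = Y.
Proof.
move=> pX pY eXY; apply: in_p_ext => // p.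
by apply: complex_parts; [have := eXY (p, false)|have := eXY (p, true)].
Qed.

Lemma pbasis_expand X : in_p X ->
  \sum_a rscale (p_coord a X) (pbasis R a) = X.
Proof.
move=> pX; apply: in_p_coord_ext => // [|b].
  by apply: in_p_sum => a; apply/in_p_rscale/in_p_pbasis.
rewrite p_coord_sum (bigD1 b) //= p_coord_rscale p_coord_pbasis eqxx mulr1.
rewrite big1 ?addr0 // => a /negPf a_b.
by rewrite p_coord_rscale p_coord_pbasis eq_sym a_b mulr0.
Qed.

(** The Killing form contributes 2n, and the entries (i,j) and (j,i) kept by [proj_ij] contribute
    equally, hence 4n. *)
Lemma tform_ordpair x X Y : in_p X -> in_p Y ->
  tform x X Y = - \sum_(p : ordpair n)
    x p * redot X Y (val p).1 (val p).2 *+ (4 * n).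
Proof.
move=> pX pY; rewrite /tform -sumrN; apply: eq_bigr => p _.
rewrite /Q killingE; try exact: in_p_proj_ij.
rewrite mulrN -mulrnAr; congr (- (_ * _)).
have pp Z : in_p Z -> in_p (proj_ij p Z) by exact: in_p_proj_ij.
rewrite sum_ordpair_sym; last 2 first.
- by move=> i j; apply: redot_sym; apply: pp.
- by move=> i; apply: redot_diag; apply: pp.
rewrite -mulrnA mulnA; congr (_ *+ _).
rewrite (bigD1 p) //= big1 ?addr0 => [|q q_p].
  by rewrite /redot !mxE /= -surjective_pairing eqxx orbT.
rewrite /redot mxE -surjective_pairing -(inj_eq val_inj) in q_p *.
rewrite (negPf q_p); case: eqP => [e|_]; last by rewrite mul0r.
by have := valP p; rewrite /= -e /= ltnNge ltnW ?(valP q).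
Qed.

Lemma tformE x X Y : in_p X -> in_p Y ->
  tform x X Y = - (\sum_i \sum_j sx x i j * redot X Y i j) *+ (2 * n).
Proof.
move=> pX pY; rewrite tform_ordpair // sumrMnl mulNrn.
rewrite sum_ordpair_sym => [|i j|i]; last by rewrite sxx mul0r.
  rewrite -mulrnA mulnA; congr (- (_ *+ _)).
  by apply: eq_bigr => p _; rewrite sxE.
by rewrite sxC redot_sym.
Qed.

Lemma redot_pbasis X a p :
  redot X (pbasis R a) (val p).1 (val p).2 = - p_coord a X *+ (a.1 == p).
Proof.
rewrite /redot -[pbasis R a (val p).2 _]opprK -in_p_conj; last first.
  exact: in_p_pbasis.
rewrite pbasis_entry /p_coord; case: eqP => [->|_]; last first.
  by rewrite !mulr0n conjc0 oppr0 mulr0.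
case: a.2; case: (X _ _) => u v /=; rewrite ?mulr1n; ring.
Qed.

Lemma tform_pbasis x X a : in_p X ->
  tform x X (pbasis R a) = x a.1 * p_coord a X *+ (4 * n).
Proof.
move=> pX; rewrite tform_ordpair //; last exact: in_p_pbasis.
rewrite (bigD1 a.1) //= redot_pbasis eqxx big1 => [|p].
  by rewrite addr0 mulr1n mulrN mulNrn opprK.
by rewrite eq_sym => /negPf pa; rewrite redot_pbasis pa mulr0n mulr0 mul0rn.
Qed.

Lemma tform_pbasis_pbasis x a b :
  tform x (pbasis R a) (pbasis R b) = x a.1 *+ (a == b) *+ (4 * n).
Proof.
rewrite tform_pbasis ?p_coord_pbasis; last exact: in_p_pbasis.
by rewrite eq_sym; case: eqP => [->|_]; rewrite ?mulr1 ?mulr0.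
Qed.

Lemma tform_pbasis_gt0 x a : is_metric x ->
  0 < tform x (pbasis R a) (pbasis R a).
Proof.
move=> x_gt0; rewrite tform_pbasis_pbasis eqxx pmulrn_lgt0 ?x_gt0 //.
by rewrite muln_gt0 /= (leq_trans _ (ltn_ord (val a.1).1)).
Qed.

(** The weight x_ij cancels, so that the quotients in [ric] and [Umap] merely read off
    coordinates. *)
Lemma coord_tform x X a : is_metric x -> in_p X ->
  tform x X (pbasis R a) / tform x (pbasis R a) (pbasis R a) = p_coord a X.
Proof.
move=> x_gt0 pX; have := tform_pbasis_gt0 a x_gt0.
rewrite tform_pbasis_pbasis tform_pbasis // eqxx -mulrnAl => t_gt0.
by rewrite mulrAC divff ?mul1r // gt_eqF.
Qed.

End InvariantForms.

(** * Levi-Civita connection *)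

Section LeviCivita.
Variables (R : realType) (n : nat) (x : invtensor R n).
Hypothesis x_gt0 : is_metric x.
Local Notation M := 'M[R[i]]_n.
Local Notation m := (sx x).
Implicit Types (X Y Z W E : M) (a b : pidx n).

(** The tensor U of the Levi-Civita connection, solved entrywise from its defining identity. On the
    diagonal the numerator is zero, so no projection to p is needed. *)
Definition Uform X Y : M := \matrix_(i, j) \sum_k
  ((m j k - m i k) / (2 * m i j))%:C%C * (X i k * Y k j + Y i k * X k j).

Lemma in_p_Uform X Y : in_p X -> in_p Y -> in_p (Uform X Y).
Proof.
move=> pX pY; apply/in_pP; split=> [i j|i]; rewrite !mxE; last first.
  by apply: big1 => k _; rewrite subrr !mul0r.
rewrite rmorph_sum -sumrN; apply: eq_bigr => k _.
rewrite /= conj_rscale rmorphD !rmorphM /= !in_p_conj //.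
by rewrite (sxC x j i) -[m i k - _]opprB real_complexN; ring.
Qed.

(** Both sides are triple sums of weights times the cyclic products [P] of E, X, Y and [S] of E, Y,
    X; the weights agree after relabelling. *)
Lemma Uform_tform E X Y : in_p E -> in_p X -> in_p Y ->
  tform x (proj_p (brk E X)) Y + tform x X (proj_p (brk E Y))
  = 2 * tform x (Uform X Y) E.
Proof.
move=> pE pX pY.
have pEX := in_p_proj_brk pE pX; have pEY := in_p_proj_brk pE pY.
have pU := in_p_Uform pX pY.
pose P i j k := complex.Re (E i j * X j k * Y k i).
pose S i j k := complex.Re (E i j * Y j k * X k i).
rewrite !tformE // mulrnAr -mulrnDl -opprD mulrN; congr (- _ *+ _).
have -> : \sum_i \sum_j m i j * redot (proj_p (brk E X)) Y i j
    = \sum_i \sum_j \sum_k (m i j * P i k j - m i j * S k j i).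
  apply: eq_bigr => i _; apply: eq_bigr => j _; rewrite /redot mxE.
  case: eqP => [->|_].
    by rewrite sxx mul0r big1 // => k _; rewrite !mul0r subr0.
  rewrite !mxE -sumrB mulr_suml Re_bigsum mulr_sumr; apply: eq_bigr => k _.
  rewrite -mulrBr /P /S -Re_opp -Re_add; congr (_ * complex.Re _); ring.
have -> : \sum_i \sum_j m i j * redot X (proj_p (brk E Y)) i j
    = \sum_i \sum_j \sum_k (m i j * S j k i - m i j * P k i j).
  apply: eq_bigr => i _; apply: eq_bigr => j _; rewrite /redot mxE eq_sym.
  case: eqP => [->|_].
    by rewrite sxx mul0r big1 // => k _; rewrite !mul0r subr0.
  rewrite !mxE -sumrB mulr_sumr Re_bigsum mulr_sumr; apply: eq_bigr => k _.
  rewrite -mulrBr /P /S -Re_opp -Re_add; congr (_ * complex.Re _); ring.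
have -> : \sum_i \sum_j m i j * redot (Uform X Y) E i j
    = \sum_i \sum_j \sum_k (m j k - m i k) / 2 * (P j i k + S j i k).
  apply: eq_bigr => i _; apply: eq_bigr => j _; rewrite /redot mxE.
  case: (eqVneq i j) => [->|i_j].
    by rewrite sxx mul0r big1 // => k _; rewrite subrr !mul0r.
  rewrite mulr_suml Re_bigsum mulr_sumr; apply: eq_bigr => k _.
  rewrite -mulrA Re_rscale mulrA; congr (_ * _).
    by have := sx_gt0 x_gt0 i_j => /gt_eqF/negbT ?; field.
  rewrite /P /S -Re_add; congr complex.Re; ring.
(* Relabel the indices so that E carries (j, i) everywhere. *)
rewrite sum3_mulr !sum3B.
rewrite [X in X - _ + _]sum3_rot [X in _ - X + _]sum3_rot.
rewrite [X in _ - X + _]sum3_rot [X in _ + (X - _)]sum3_swap.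
rewrite [X in _ + (X - _)]sum3_rot [X in _ + (_ - X)]sum3_swap_r.
rewrite -!sum3B -sum3D; apply: eq_sum3 => i j k.
by rewrite (sxC x k i) (sxC x k j); field.
Qed.

Lemma UmapE X Y : in_p X -> in_p Y -> Umap x X Y = Uform X Y.
Proof.
move=> pX pY; rewrite -[RHS]pbasis_expand; last exact: in_p_Uform.
apply: eq_bigr => a _; congr rscale; have pa := @in_p_pbasis R n a.
rewrite Uform_tform // -(coord_tform _ x_gt0); last exact: in_p_Uform.
by rewrite -mulf_div divff ?mul1r // pnatr_eq0.
Qed.

(* The value at k = i only ever multiplies a diagonal entry of p; 0 makes the
   identities below hold without side conditions. *)
Definition alpha (i k j : 'I_n) : R :=
  if i == k then 0 else (m i j + m k j - m i k) / (2 * m i j).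

Lemma alpha_diag i k : alpha i k i = 0.
Proof. by rewrite /alpha sxx mulr0 invr0 mulr0 if_same. Qed.

Lemma alpha_l i j : alpha i i j = 0.
Proof. by rewrite /alpha eqxx. Qed.

Lemma alpha_r i k : alpha i k k = 0.
Proof. by rewrite /alpha sxx addr0 subrr mul0r if_same. Qed.

(** Defined for all complex matrices, not only on p, so that it can be evaluated at the elementary
    matrices E_pq. *)
Definition nomizu X Y : M := \matrix_(i, j) \sum_k
  ((alpha i k j)%:C%C * (X i k * Y k j) - (alpha j k i)%:C%C * (Y i k * X k j)).

Lemma LCE X Y : in_p X -> in_p Y -> LC x X Y = nomizu X Y.
Proof.
move=> pX pY; rewrite /LC UmapE //; apply/matrixP => i j; rewrite !mxE.
case: (eqVneq i j) => [<-|i_j].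
  rewrite mulr0 add0r; apply: eq_bigr => k _.
  by rewrite alpha_diag subrr !mul0r subr0.
rewrite -sumrB mulr_sumr -big_split /=; apply: eq_bigr => k _.
case: (eqVneq i k) => [<-|i_k].
  by rewrite !in_p_diag // !(mul0r, mulr0, addr0, subr0).
case: (eqVneq j k) => [<-|j_k].
  by rewrite !in_p_diag // !(mul0r, mulr0, addr0, subr0).
have := sx_gt0 x_gt0 i_j => /gt_eqF/negbT m_ij.
(* The bracket contributes 1/2 and -1/2 to the two products, and U contributes t to both. *)
set t := (m j k - m i k) / (2 * m i j).
have -> : alpha i k j = 2^-1 + t.
  by rewrite /alpha (negPf i_k) /t (sxC x k j); field.
have -> : alpha j k i = 2^-1 - t.
  by rewrite /alpha (negPf j_k) /t (sxC x j i) (sxC x k i); field.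
rewrite !real_complexD real_complexN /=; ring.
Qed.

Lemma in_p_nomizu X Y : in_p X -> in_p Y -> in_p (nomizu X Y).
Proof.
move=> pX pY; apply/in_pP; split=> [i j|i]; rewrite !mxE.
  rewrite rmorph_sum -sumrN; apply: eq_bigr => k _.
  rewrite /= rmorphB /= !conj_rscale !rmorphM /= !in_p_conj // !mulrNN opprB.
  by rewrite [X k i * _]mulrC [Y k i * _]mulrC.
by apply: big1 => k _; rewrite alpha_diag !mul0r subr0.
Qed.

End LeviCivita.

(** * Ricci and scalar curvature *)

Section Ricci.
Variables (R : realType) (n : nat) (x : invtensor R n).
Hypothesis x_gt0 : is_metric x.
Local Notation M := 'M[R[i]]_n.
Local Notation m := (sx x).
Local Notation alpha := (alpha x).
Local Notation nomizu := (nomizu x).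
Implicit Types (X Y Z W : M) (a b : pidx n).

Lemma nomizu_linear_l Z c X Y :
  nomizu (c *: X + Y) Z = c *: nomizu X Z + nomizu Y Z.
Proof.
apply/matrixP => i j; rewrite !mxE mulr_sumr -big_split.
by apply: eq_bigr => k _; rewrite !mxE /=; ring.
Qed.

Lemma nomizu_linear_r Z c X Y :
  nomizu Z (c *: X + Y) = c *: nomizu Z X + nomizu Z Y.
Proof.
apply/matrixP => i j; rewrite !mxE mulr_sumr -big_split.
by apply: eq_bigr => k _; rewrite !mxE /=; ring.
Qed.

Lemma proj_p_linear c X Y : proj_p (c *: X + Y) = c *: proj_p X + proj_p Y.
Proof.
by apply/matrixP => i j; rewrite !mxE; case: eqP; rewrite // mulr0 addr0.
Qed.

Lemma proj_t_linear c X Y : proj_t (c *: X + Y) = c *: proj_t X + proj_t Y.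
Proof.
by apply/matrixP => i j; rewrite !mxE; case: eqP; rewrite // mulr0 addr0.
Qed.

(** The argument X comes last because Ricci is the trace over it; the map is complex linear in X, so
    this trace can be taken over the E_pq. *)
Definition curv Y Z X : M :=
  nomizu X (nomizu Y Z) - nomizu Y (nomizu X Z)
  - nomizu (proj_p (brk X Y)) Z - brk (proj_t (brk X Y)) Z.

Lemma curv_linear Y Z c X W :
  curv Y Z (c *: X + W) = c *: curv Y Z X + curv Y Z W.
Proof.
rewrite /curv !(nomizu_linear_l, nomizu_linear_r, brk_linear_l,
  proj_p_linear, proj_t_linear) !scalerBr.
by apply/matrixP => i j; rewrite !mxE; ring.
Qed.

Lemma riemE X Y Z : in_p X -> in_p Y -> in_p Z -> riem x X Y Z = curv Y Z X.
Proof.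
move=> pX pY pZ; have pXY := in_p_proj_brk pX pY.
by rewrite /riem !LCE //; apply: in_p_nomizu.
Qed.

Lemma in_pB X Y : in_p X -> in_p Y -> in_p (X - Y).
Proof.
move=> pX pY; apply/in_pP; split=> [i j|i]; rewrite !mxE.
  by rewrite rmorphB /= !in_p_conj // opprD.
by rewrite !in_p_diag // subrr.
Qed.

Lemma brk_proj_tE X Z i j :
  brk (proj_t X) Z i j = (X i i - X j j) * Z i j.
Proof.
rewrite /brk !mxE (bigD1 i) //= big1 => [|k /negPf k_i]; last first.
  by rewrite mxE eq_sym k_i mul0r.
rewrite [X in _ - X](bigD1 j) //= big1 => [|k /negPf k_j].
  by rewrite !mxE !eqxx; ring.
by rewrite mxE k_j mulr0.
Qed.

Lemma in_p_riem X Y Z : in_p X -> in_p Y -> in_p Z -> in_p (riem x X Y Z).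
Proof.
move=> pX pY pZ; rewrite riemE //.
have pXY := in_p_proj_brk pX pY.
have pt : in_p (brk (proj_t (brk X Y)) Z).
  have brk_conj i : conjc (brk X Y i i) = - brk X Y i i.
    rewrite !mxE rmorphB !rmorph_sum /= opprB; congr (_ - _);
    by apply: eq_bigr => k _; rewrite rmorphM /= !in_p_conj // mulrNN mulrC.
  apply/in_pP; split=> [i j|i]; rewrite !brk_proj_tE.
    by rewrite rmorphM rmorphB /= !brk_conj in_p_conj //; ring.
  by rewrite subrr mul0r.
by apply/in_pB => //; apply/in_pB; [apply/in_pB|]; do 2?apply: in_p_nomizu.
Qed.

Lemma nomizu_delta Z p q i j : nomizu (delta_mx p q) Z i j
  = (alpha i q j)%:C%C * Z q j *+ (i == p)
    - (alpha j p i)%:C%C * Z i p *+ (j == q).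
Proof.
rewrite mxE sumrB; congr (_ - _).
  rewrite (bigD1 q) //= big1 ?addr0 => [|k /negPf k_q]; rewrite mxE.
    by rewrite eqxx andbT; case: (i == p); rewrite ?mul1r ?mul0r ?mulr0.
  by rewrite k_q andbF mul0r mulr0.
rewrite (bigD1 p) //= big1 ?addr0 => [|k /negPf k_p]; rewrite mxE.
  by rewrite eqxx; case: (j == q); rewrite ?mulr1 ?mulr0.
by rewrite k_p mulr0 mulr0.
Qed.

Lemma curv_delta Y Z p q : in_p Y -> in_p Z -> p != q ->
  curv Y Z (delta_mx p q) p q = \sum_k (
      (alpha p k q * alpha q p k)%:C%C * (Y p k * Z k p)
    + (alpha q k p * alpha p q k)%:C%C * (Z q k * Y k q)
    - (alpha p k q)%:C%C * (Y q k * Z k q)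
    - (alpha q k p)%:C%C * (Z p k * Y k p)) - 2 * (Y q p * Z p q).
Proof.
move=> pY pZ /negPf p_q; have q_p := p_q; rewrite eq_sym in q_p.
have brkE i j :
    brk (delta_mx p q) Y i j = Y q j *+ (i == p) - Y i p *+ (j == q).
  by rewrite /brk mxE mul_delta_mxE mxE mul_mx_deltaE.
have entry (A B C D : M) : (A - B - C - D) p q = A p q - B p q - C p q - D p q.
  by rewrite !mxE.
rewrite /curv entry.
(* The coefficients of this entry are [alpha p q q] and [alpha q p p], both 0. *)
have -> : nomizu (delta_mx p q) (nomizu Y Z) p q = 0.
  by rewrite nomizu_delta !alpha_r !mul0r !mul0rn subr0.
have -> : brk (proj_t (brk (delta_mx p q) Y)) Z p q = 2 * (Y q p * Z p q).
  rewrite brk_proj_tE !brkE !eqxx p_q q_p !mulr0n !mulr1n; ring.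
congr (_ - _); rewrite sub0r -opprD.
rewrite [nomizu Y _ _ _]mxE [nomizu (proj_p _) _ _ _]mxE -big_split -sumrN.
apply: eq_bigr => k _ /=; rewrite !nomizu_delta !alpha_r !mul0r !mul0rn.
have projE i j : proj_p (brk (delta_mx p q) Y) i j
    = if i == j then 0 else Y q j *+ (i == p) - Y i p *+ (j == q).
  by rewrite mxE brkE.
rewrite !eqxx !projE.
case: (eqVneq p k) => [<-|p_k].
  rewrite p_q alpha_l !in_p_diag // !mul0rn !mulr1n.
  by rewrite !real_complexM real_complex0; ring.
case: (eqVneq k q) => [->|k_q].
  rewrite !alpha_r alpha_l !in_p_diag // !mul0rn !mulr1n.
  by rewrite !real_complexM real_complex0; ring.
by rewrite !eqxx !real_complexM !mulr1n ?mulr0n; ring.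
Qed.

(** The share of E_pq in the trace defining [ric]. *)
Definition ric_entry Y Z p q : R := \sum_k
    (alpha p k q * alpha q p k * redot Y Z p k
     + alpha q k p * alpha p q k * redot Y Z k q
     - alpha p k q * redot Y Z q k - alpha q k p * redot Y Z k p)
  - 2 * redot Y Z q p.

Lemma Re_curv_delta Y Z p q : in_p Y -> in_p Z -> p != q ->
  complex.Re (curv Y Z (delta_mx p q) p q) = ric_entry Y Z p q.
Proof.
move=> pY pZ p_q; rewrite curv_delta // Re_add Re_bigsum Re_opp /ric_entry.
congr (_ - _).
  apply: eq_bigr => k _; rewrite !Re_add !Re_opp !Re_rscale /redot.
  by congr (_ + _ * complex.Re _ - _ - _ * complex.Re _); rewrite mulrC.
by rewrite -[2](_ : 2%:R%:C%C = _) ?Re_rscale //; congr Complex; rewrite addr0.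
Qed.

Lemma ric_entry_sym Y Z p q : in_p Y -> in_p Z ->
  ric_entry Y Z p q = ric_entry Y Z q p.
Proof.
move=> pY pZ; rewrite /ric_entry (redot_sym q p) //; congr (_ - _).
apply: eq_bigr => k _; rewrite (redot_sym q k) // (redot_sym p k) //; ring.
Qed.

Lemma ric_entry_diag Y Z p : in_p Y -> ric_entry Y Z p p = 0.
Proof.
move=> pY; rewrite /ric_entry redot_diag // mulr0 subr0 big1 // => k _.
rewrite alpha_diag; ring.
Qed.

(* Half the eigenvalue on p_ij of ric with respect to - Re tr (X Y). *)
Definition ric_coef i j : R :=
  1 + \sum_k (m i j ^+ 2 - (m i k - m j k) ^+ 2) / (4 * m i k * m j k).

(** Half the coefficient that the relabelled trace gives to Y_ij Z_ji. For k = i or k = j both sides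
    are 0, the right one by the convention 1/0 = 0. *)
Lemma alpha_mul i j k : i != j -> alpha k i j * (alpha i j k - 1)
  = - ((m i j ^+ 2 - (m i k - m j k) ^+ 2) / (4 * m i k * m j k)).
Proof.
move=> i_j; case: (eqVneq k i) => [->|k_i].
  by rewrite alpha_l sxx mulr0 mul0r invr0 mulr0 oppr0 mul0r.
case: (eqVneq k j) => [->|k_j].
  by rewrite alpha_diag sxx mulr0 invr0 mulr0 oppr0 mul0r.
have /gt_eqF/negbT m_ki := sx_gt0 x_gt0 k_i.
have /gt_eqF/negbT m_kj := sx_gt0 x_gt0 k_j.
rewrite /alpha (negPf k_i) (negPf i_j) (sxC x i k) (sxC x j k).
by field; rewrite m_kj m_ki.
Qed.

Lemma ricE Y Z : in_p Y -> in_p Z ->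
  ric x Y Z = - 2 * \sum_i \sum_j ric_coef i j * redot Y Z i j.
Proof.
move=> pY pZ; transitivity (\sum_i \sum_j ric_entry Y Z i j).
  rewrite sum_ordpair_sym => [|i j|i]; last exact: ric_entry_diag.
    rewrite /ric (eq_bigr (fun a => p_coord a (curv Y Z (pbasis R a)))).
      rewrite sum_pidx -sumrMnl; apply: eq_bigr => p _.
      have -> := p_coord_trace p (curv_linear Y Z).
      by rewrite Re_curv_delta ?ordpair_neq // mulr_natl.
    move=> a _; have pa := @in_p_pbasis R n a.
    by rewrite coord_tform //; [rewrite riemE|apply: in_p_riem].
  exact: ric_entry_sym.
transitivity (\sum_i \sum_j \sum_k
    2 * (alpha k i j * (alpha i j k - 1) * redot Y Z i j)
    - 2 * \sum_i \sum_j redot Y Z i j).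
  rewrite /ric_entry -sum3_mulr.
  under eq_bigr do rewrite sumrB; rewrite sumrB; congr (_ - _); last first.
    rewrite mulr_sumr; apply: eq_bigr => i _; rewrite mulr_sumr.
    by apply: eq_bigr => j _; rewrite redot_sym.
  (* Relabel the four terms so that Y and Z carry i and j: the two quadratic ones then coincide, and
     so do the two linear ones. *)
  rewrite 2!sum3B sum3D [X in X + _ - _ - _]sum3_swap_r.
  rewrite [X in _ + X - _ - _]sum3_rot [X in _ + X - _ - _]sum3_rot.
  rewrite [X in _ - X - _]sum3_swap [X in _ - X - _]sum3_rot.
  rewrite [X in _ - _ - X]sum3_rot -sum3D -2!sum3B sum3_mulr.
  by apply: eq_sum3 => i j k; rewrite (redot_sym j i pY pZ); ring.
rewrite -sum3_mulr -mulrBr mulNr -mulrN; congr (2 * _).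
rewrite -sumrB -sumrN; apply: eq_bigr => i _; rewrite -sumrB -sumrN.
apply: eq_bigr => j _; case: (eqVneq i j) => [->|i_j].
  by rewrite redot_diag // mulr0 big1 ?subr0 ?oppr0 // => k _; rewrite mulr0.
rewrite -mulr_suml /ric_coef (eq_bigr _ (fun k _ => alpha_mul k i_j)) sumrN.
ring.
Qed.

Lemma ric_coef_sym i j : ric_coef i j = ric_coef j i.
Proof.
rewrite /ric_coef; congr (1 + _); apply: eq_bigr => k _.
by rewrite sxC -[m i k - _]opprB sqrrN mulrAC.
Qed.

Lemma ric_pbasis a : ric x (pbasis R a) (pbasis R a)
  = 4 * ric_coef (val a.1).1 (val a.1).2.
Proof.
have pa := @in_p_pbasis R n a; rewrite ricE //.
rewrite sum_ordpair_sym => [|i j|i]; last by rewrite redot_diag ?mulr0.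
  rewrite (bigD1 a.1) //= big1 => [|p]; last first.
    by rewrite eq_sym => /negPf pa1; rewrite redot_pbasis pa1 mulr0n mulr0.
  by rewrite redot_pbasis eqxx p_coord_pbasis eqxx !mulr1n; ring.
by rewrite ric_coef_sym redot_sym.
Qed.

Lemma scal_ric_coef :
  scal x = n%:R^-1 * \sum_i \sum_j ric_coef i j / m i j.
Proof.
rewrite sum_ordpair_sym => [|i j|i]; first last.
- by rewrite sxx invr0 mulr0.
- by rewrite ric_coef_sym sxC.
rewrite /scal sum_pidx -sumrMnl mulr_sumr; apply: eq_bigr => p _.
rewrite !ric_pbasis !tform_pbasis_pbasis !eqxx /= sxE.
have n_neq0 : n%:R != 0 :> R.
  by rewrite pnatr_eq0 -lt0n (leq_trans _ (ltn_ord (val p).1)).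
by have := x_gt0 p => /gt_eqF/negbT x_p; field; rewrite x_p n_neq0.
Qed.

(** Expanding the square in [ric_coef] gives m_ij / (m_ik m_jk) minus two relabelled copies of it.
    All three have the same total, so one negative copy remains. *)
Lemma scalE : scal x = 2^-1 * \sum_i \sum_j (m i j)^-1
  - (4 * n%:R)^-1 * \sum_i \sum_j \sum_k m i j / (m i k * m j k).
Proof.
rewrite scal_ric_coef; have [n0|n_gt0] := posnP n.
  have sum0 (F : 'I_n -> R) : \sum_i F i = 0.
    by apply: big1 => -[i lt_i]; lia.
  by rewrite !sum0 !mulr0 subr0.
have n_neq0 : n%:R != 0 :> R by rewrite pnatr_eq0 -lt0n.
pose T i j k := m i j / (m i k * m j k).
have -> : \sum_i \sum_j ric_coef i j / m i j =
    \sum_i \sum_j (n%:R / 2) * (m i j)^-1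
    + \sum_i \sum_j \sum_k 4^-1 * (T i j k - T i k j - T j k i).
  rewrite -big_split; apply: eq_bigr => i _ /=; rewrite -big_split.
  apply: eq_bigr => j _ /=; case: (eqVneq i j) => [<-|i_j].
    rewrite sxx invr0 !mulr0 add0r big1 // => k _.
    by rewrite /T sxx !(mul0r, mulr0, invr0); ring.
  have /gt_eqF/negbT m_ij := sx_gt0 x_gt0 i_j.
  (* The indicator of k outside {i, j}: the cross term 1/(2 m_ij) occurs for these n - 2 values of k
     only, and together with the leading 1 of [ric_coef] gives n/(2 m_ij). *)
  pose d k : R := 1 - (k == i)%:R - (k == j)%:R.
  have sum_d : \sum_k d k = n%:R - 2.
    have sum_eq (l : 'I_n) : \sum_(k < n) (k == l)%:R = 1 :> R.
      by rewrite (bigD1 l) //= eqxx big1 ?addr0 // => k /negPf->.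
    by rewrite !sumrB sumr_const card_ord !sum_eq; ring.
  rewrite /ric_coef mulrDl mul1r mulr_suml.
  rewrite [X in _ + X](eq_bigr (fun k =>
     4^-1 * (T i j k - T i k j - T j k i) + (2 * m i j)^-1 * d k)).
    rewrite big_split /= -[X in _ + (_ + X)]mulr_sumr sum_d.
    by rewrite addrA addrAC; congr (_ + _); field.
  move=> k _; rewrite /T /d; case: (eqVneq k i) => [->|k_i].
    by rewrite sxx (negPf i_j) !(mul0r, mulr0, invr0) /= !(mulr0n,mulr1n); ring.
  case: (eqVneq k j) => [->|k_j].
    by rewrite sxx !(mul0r, mulr0, invr0) /= !(mulr0n,mulr1n); ring.
  have /gt_eqF/negbT m_ki := sx_gt0 x_gt0 k_i.
  have /gt_eqF/negbT m_kj := sx_gt0 x_gt0 k_j.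
  rewrite (sxC x i k) (sxC x j k) (sxC x j i) /= !mulr0n.
  by field; rewrite m_ki m_kj m_ij.
rewrite -sum3_mulr 2!sum3B.
rewrite [X in _ * (_ - X - _)]sum3_swap_r [X in _ * (_ - _ - X)]sum3_rot.
rewrite [X in _ * (_ - _ - X)]sum3_rot.
under eq_bigr do rewrite -mulr_sumr; rewrite -mulr_sumr.
rewrite -[X in _ = _ - _ * X]/(\sum_i \sum_j \sum_k T i j k).
by field.
Qed.

End Ricci.

(** * Derivatives of sums of exponentials *)

Section Derivatives.
Variable R : realType.

Lemma is_derive_bigsum (I : finType) (h : I -> R -> R) (dh : I -> R) (t : R) :
  (forall i, is_derive t 1 (h i) (dh i)) ->
  is_derive t 1 (fun s => \sum_i h i s) (\sum_i dh i).
Proof.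
move=> dhP; rewrite (_ : (fun s => _) = \sum_i h i); last first.
  by apply/funext => s; rewrite fct_sumE.
elim/big_ind2 : _ => // [|? ? ? ? ? ?]; first exact: is_derive_cst.
exact: is_deriveD.
Qed.

Lemma is_derive_expR_affine (a b c t : R) :
  is_derive t 1 (fun s => a * expR (b + s * c)) (a * c * expR (b + t * c)).
Proof.
have daff : is_derive t 1 (fun s : R => b + s * c) c.
  rewrite (_ : (fun s => _) = cst b + c \*: id); last first.
    by apply/funext => s /=; rewrite mulrC.
  have := is_deriveD (is_derive_cst b t 1) (is_deriveZ c (is_derive_id t 1)).
  by rewrite add0r /GRing.scale /= mulr1.
have := is_deriveZ a (is_derive1_comp (g := fun s => b + s * c) (x := t)
  (is_derive_expR _) daff).
by rewrite /GRing.scale /= -mulrA [c * _]mulrC.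
Qed.

End Derivatives.

(** * The Hessian in logarithmic variations *)

Section Hessian.
Variables (R : realType) (n : nat) (x : invtensor R n).
Hypothesis x_gt0 : is_metric x.
Local Notation m := (sx x).
Implicit Types (S T U : invtensor R n) (i j k : 'I_n).

(* The curve of metrics x exp (x^-1 U) is read through the logarithmic
   variations U_ij / x_ij, in which every monomial of scal is an exponential. *)
Definition logvar U i j : R := sx U i j / m i j.
Definition logvar3 U i j k : R := logvar U i j - logvar U i k - logvar U j k.

Lemma sx_linear s t S T i j :
  sx (s *: S + t *: T) i j = s * sx S i j + t * sx T i j.
Proof.
rewrite /sx; case: insub => [p|]; first by rewrite !ffunE.
by case: insub => [p|]; rewrite ?ffunE // !mulr0 addr0.
Qed.

Lemma logvar_linear s t S T i j :
  logvar (s *: S + t *: T) i j = s * logvar S i j + t * logvar T i j.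
Proof. by rewrite /logvar sx_linear mulrDl !mulrA. Qed.

Lemma metric_chart_gt0 U : is_metric (metric_chart x U).
Proof. by move=> p; rewrite ffunE mulr_gt0 // expR_gt0. Qed.

Lemma sx_metric_chart U i j :
  sx (metric_chart x U) i j = m i j * expR (logvar U i j).
Proof.
rewrite /logvar /sx; case: insub => [p|]; first by rewrite ffunE.
by case: insub => [p|]; rewrite ?ffunE // mul0r.
Qed.

(** The shape of [scal] along a line in the chart, with amplitudes a, initial exponents u and rates
    v. Differentiation preserves it and multiplies each amplitude by its rate. *)
Definition expscal (a2 u2 v2 : 'I_n -> 'I_n -> R)
    (a3 u3 v3 : 'I_n -> 'I_n -> 'I_n -> R) (t : R) : R :=
  2^-1 * \sum_i \sum_j a2 i j * expR (u2 i j + t * v2 i j)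
  - (4 * n%:R)^-1 * \sum_i \sum_j \sum_k
      a3 i j k * expR (u3 i j k + t * v3 i j k).

Lemma derive_expscal a2 u2 v2 a3 u3 v3 (t : R) :
  derive1 (expscal a2 u2 v2 a3 u3 v3) t
  = expscal (fun i j => a2 i j * v2 i j) u2 v2
      (fun i j k => a3 i j k * v3 i j k) u3 v3 t.
Proof.
rewrite derive1E; apply: derive_val; rewrite /expscal.
apply: is_deriveB; apply: is_deriveZ.
  by do 2!apply: is_derive_bigsum => ?; apply: is_derive_expR_affine.
by do 3!apply: is_derive_bigsum => ?; apply: is_derive_expR_affine.
Qed.

(** The exponents are linear in s and t, so differentiating twice just brings down the product of
    the two rates. *)
Lemma scal_hessE S T : scal_hess x S T
  = 2^-1 * \sum_i \sum_j logvar S i j * logvar T i j / m i j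
  - (4 * n%:R)^-1 * \sum_i \sum_j \sum_k
      m i j / (m i k * m j k) * (logvar3 S i j k * logvar3 T i j k).
Proof.
pose a2 i j := (m i j)^-1; pose a3 i j k := m i j / (m i k * m j k).
pose v2 U i j := - logvar U i j; pose v3 U i j k := logvar3 U i j k.
(* The inner derivative at t = 0 is again of the same shape, as a function of s. *)
rewrite /scal_hess (_ : (fun s => _) = expscal (fun i j => a2 i j * v2 T i j)
    (fun _ _ => 0) (v2 S) (fun i j k => a3 i j k * v3 T i j k)
    (fun _ _ _ => 0) (v3 S)).
  rewrite derive_expscal /expscal; congr (_ * _ - _ * _).
    apply: eq_bigr => i _; apply: eq_bigr => j _.
    by rewrite mul0r addr0 expR0 /v2 /a2; ring.
  apply: eq_sum3 => i j k; rewrite mul0r addr0 expR0 /v3 /a3; ring.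
apply/funext => s; rewrite (_ : (fun t => _) = expscal a2
    (fun i j => s * v2 S i j) (v2 T) a3 (fun i j k => s * v3 S i j k) (v3 T)).
  rewrite derive_expscal /expscal; congr (_ * _ - _ * _).
    apply: eq_bigr => i _; apply: eq_bigr => j _.
    by rewrite mul0r addr0 add0r.
  by apply: eq_sum3 => i j k; rewrite mul0r addr0 add0r.
apply/funext => t; rewrite scalE; last exact: metric_chart_gt0.
rewrite /expscal; congr (_ * _ - _ * _).
  apply: eq_bigr => i _; apply: eq_bigr => j _.
  rewrite sx_metric_chart invfM -expRN logvar_linear /a2 /v2 opprD.
  by rewrite -!mulrN.
apply: eq_sum3 => i j k; rewrite !sx_metric_chart /a3 /v3 /logvar3.
have -> : s * (logvar S i j - logvar S i k - logvar S j k)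
    + t * (logvar T i j - logvar T i k - logvar T j k)
  = logvar (s *: S + t *: T) i j - logvar (s *: S + t *: T) i k
    - logvar (s *: S + t *: T) j k by rewrite !logvar_linear; ring.
by rewrite !expRD !expRN !invfM; ring.
Qed.

(** Each p_ij carries two basis vectors, so the trace is twice the sum over i < j, that is, the full
    double sum. *)
Lemma in_TTE T : in_TT x T <-> \sum_i \sum_j logvar T i j = 0.
Proof.
have -> : \sum_i \sum_j logvar T i j = tensor_trace x T; last by [].
rewrite sum_ordpair_sym => [|i j|i]; first last.
- by rewrite /logvar !sxx mul0r.
- by rewrite /logvar sxC [m i j]sxC.
rewrite /tensor_trace sum_pidx -sumrMnl; apply: eq_bigr => p _.
rewrite !tform_pbasis_pbasis !eqxx !mulr1n /= /logvar !sxE.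
have n_neq0 : n%:R != 0 :> R.
  by rewrite pnatr_eq0 -lt0n (leq_trans _ (ltn_ord (val p).1)).
have /gt_eqF/negbT x_p := x_gt0 p.
by field; rewrite x_p n_neq0.
Qed.

End Hessian.

(** * Rescaling to unit volume *)

Section Rescaling.
Variables (R : realType) (n : nat).
Implicit Types (x : invtensor R n) (c : R).

Lemma sxZ c x i j : sx (c *: x) i j = c * sx x i j.
Proof.
rewrite /sx; case: insub => [p|]; first by rewrite ffunE.
by case: insub => [p|]; rewrite ?ffunE // mulr0.
Qed.

Lemma is_metricZ c x : 0 < c -> is_metric x -> is_metric (c *: x).
Proof. by move=> c_gt0 x_gt0 p; rewrite ffunE mulr_gt0. Qed.

Lemma ric_coefZ c x i j : c != 0 -> ric_coef (c *: x) i j = ric_coef x i j.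
Proof.
move=> c_neq0; rewrite /ric_coef; congr (1 + _); apply: eq_bigr => k _.
have cc : c * c != 0 by rewrite mulf_neq0.
rewrite !sxZ -mulrBr !exprMn -mulrBr expr2 -[RHS]mul1r -(divff cc).
by rewrite !invfM; ring.
Qed.

Lemma det_gram x : \det (gram x) = \prod_(a : 'I_#|{: pidx n}|)
  (x (enum_val a).1 *+ (4 * n)).
Proof.
rewrite (_ : gram x = diag_mx (\row_a (x (enum_val a).1 *+ (4 * n)))).
  by rewrite det_diag; apply: eq_bigr => a _; rewrite mxE.
apply/matrixP => a b; rewrite !mxE tform_pbasis_pbasis (inj_eq enum_val_inj).
by rewrite mulrnAC.
Qed.

Lemma det_gram_gt0 x : is_metric x -> 0 < \det (gram x).
Proof.
move=> x_gt0; rewrite det_gram; apply: prodr_gt0 => a _.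
have := tform_pbasis_gt0 (enum_val a) x_gt0.
by rewrite tform_pbasis_pbasis eqxx.
Qed.

Lemma det_gramZ c x : \det (gram (c *: x)) = c ^+ #|{: pidx n}| * \det (gram x).
Proof.
rewrite !det_gram -[X in c ^+ X]card_ord -prodr_const -big_split.
by apply: eq_bigr => a _; rewrite ffunE -mulrnAr.
Qed.

Lemma unit_volume_scale v0 x : 0 < v0 -> is_metric x -> (0 < #|{: pidx n}|)%N ->
  exists2 c, 0 < c & in_M1 v0 (c *: x).
Proof.
move=> v0_gt0 x_gt0; set N := #|_| => N_gt0.
have D1_gt0 : 0 < \det (gram ([ffun=> 1] : invtensor R n)).
  by apply: det_gram_gt0 => p; rewrite ffunE.
set D1 := \det _ in D1_gt0.
have D_gt0 := det_gram_gt0 x_gt0; set D := \det _ in D_gt0.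
(* With c^N = r the volume v0 sqrt(c^N D / D1) equals 1. *)
pose r := (v0 ^+ 2)^-1 * (D1 / D).
have r_gt0 : 0 < r by rewrite mulr_gt0 ?invr_gt0 ?exprn_gt0 ?divr_gt0.
exists (r `^ N%:R^-1); first exact: powR_gt0.
split; first by apply: is_metricZ => //; apply: powR_gt0.
rewrite /volume det_gramZ -/D -/D1 -/N -powR_mulrn ?powR_ge0 // -powRrM.
rewrite mulVf ?pnatr_eq0 -?lt0n // powRr1 ?ltW // /r.
rewrite (_ : _ * D / D1 = v0^-1 ^+ 2).
  by rewrite sqrtr_sqr gtr0_norm ?invr_gt0 // divff ?gt_eqF.
by rewrite exprVn; field; rewrite !gt_eqF.
Qed.

(** A property proved for all positive multiples holds at unit volume, whatever the value of c. *)
Lemma at_unit_volumeP v0 x (P : invtensor R n -> Prop) :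
  0 < v0 -> is_metric x -> (0 < #|{: pidx n}|)%N ->
  (forall c, 0 < c -> P (c *: x)) -> at_unit_volume v0 P x.
Proof.
move=> v0_gt0 x_gt0 N_gt0 Pcx.
have [c c_gt0 cx_M1] := unit_volume_scale v0_gt0 x_gt0 N_gt0.
by exists c; split=> //; apply: Pcx.
Qed.

(** The factor n comes from the normalisations: [ric] carries -2 and [tform] carries -2n. *)
Lemma einstein_ric_coef x (rho : R) : is_metric x ->
  (forall i j, i != j -> ric_coef x i j = rho * n%:R * sx x i j) -> einstein x.
Proof.
move=> x_gt0 rhoP; exists rho => X Y pX pY; rewrite ricE // tformE //.
have -> : \sum_i \sum_j ric_coef x i j * redot X Y i j
    = rho * n%:R * \sum_i \sum_j sx x i j * redot X Y i j.
  rewrite mulr_sumr; apply: eq_bigr => i _; rewrite mulr_sumr.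
  apply: eq_bigr => j _; case: (eqVneq i j) => [->|/rhoP->].
    by rewrite redot_diag // !mulr0.
  by rewrite mulrA.
by rewrite -[in RHS]mulr_natr natrM; ring.
Qed.

End Rescaling.

(** * Metrics |h_i - h_j| *)

Section LinearMetric.
Variables (R : realType) (n : nat) (x : invtensor R n) (h : 'I_n -> R).
Hypothesis h_inj : injective h.
Hypothesis x_h : forall i j, sx x i j = `|h i - h j|.
Local Notation M := 'M[R[i]]_n.
Implicit Types (X Y : M).

Lemma linear_metric : is_metric x.
Proof.
by move=> p; rewrite -sxE x_h normr_gt0 subr_eq0 (inj_eq h_inj) ordpair_neq.
Qed.

Definition cpx_struct X : M :=
  \matrix_(i, j) (Complex 0 (Num.sg (h i - h j)) * X i j).

Lemma sgB_sqr i j : i != j -> Num.sg (h i - h j) * Num.sg (h i - h j) = 1.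
Proof.
by move=> i_j; rewrite -expr2 sqr_sg subr_eq0 (inj_eq h_inj) i_j.
Qed.

(* The two signs agree unless b lies between a and c, where the first factor
   vanishes. *)
Lemma sg_between (a b c : R) :
  (`|a - b| + `|c - b| - `|a - c|) * Num.sg (c - b)
  = (`|a - b| + `|c - b| - `|a - c|) * Num.sg (a - b).
Proof.
have [ab|ab|->] := ltgtP a b; have [cb|cb|->] := ltgtP c b;
  rewrite ?subrr ?normr0 ?sgr0 ?mulr0 //; last 2 first.
- by rewrite add0r distrC subrr mul0r.
- by rewrite add0r distrC subrr mul0r.
- by rewrite !ltr0_sg ?subr_lt0.
- rewrite (ltr0_norm (x := a - b)) ?(gtr0_norm (x := c - b)) //;
    rewrite ?subr_lt0 ?subr_gt0 //.
  rewrite ltr0_norm ?subr_lt0 ?(lt_trans ab) //; ring.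
- by rewrite addr0 subrr mul0r.
- rewrite (gtr0_norm (x := a - b)) ?(ltr0_norm (x := c - b)) //;
    rewrite ?subr_lt0 ?subr_gt0 //.
  rewrite gtr0_norm ?subr_gt0 ?(lt_trans cb) //; ring.
- by rewrite !gtr0_sg ?subr_gt0.
- by rewrite addr0 subrr mul0r.
Qed.

(** This is the parallelism of [cpx_struct], one product X_ik Y_kj at a time. *)
Lemma alpha_sg i k j :
  alpha x i k j * Num.sg (h k - h j) = alpha x i k j * Num.sg (h i - h j).
Proof.
rewrite /alpha; case: eqP => _; first by rewrite !mul0r.
by rewrite !x_h mulrAC sg_between mulrAC.
Qed.

Lemma in_p_cpx_struct X : in_p X -> in_p (cpx_struct X).
Proof.
move=> pX; apply/in_pP; split=> [i j|i]; rewrite !mxE; last first.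
  by rewrite in_p_diag // mulr0.
have cN (s : R) : Complex 0 (- s) = - Complex 0 s.
  by congr Complex; rewrite oppr0.
by rewrite rmorphM /= in_p_conj // -[h j - _]opprB sgrN !cN; ring.
Qed.

Lemma cpx_struct_nomizu X Y : in_p X -> in_p Y ->
  nomizu x X (cpx_struct Y) = cpx_struct (nomizu x X Y).
Proof.
move=> pX pY; apply/matrixP => i j; rewrite !mxE mulr_sumr.
apply: eq_bigr => k _; rewrite !mxE mulrBr.
have cE (r s : R) : Complex 0 (r * s) = r%:C%C * Complex 0 s.
  by congr Complex; rewrite /= ?mulr0 ?mul0r; ring.
have e1 := alpha_sg i k j.
(* Reversing both differences turns this into [alpha_sg] at (j, k, i). *)
have e2 : alpha x j k i * Num.sg (h i - h k)
    = alpha x j k i * Num.sg (h i - h j).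
  by rewrite -![h i - _]opprB !sgrN !mulrN alpha_sg.
congr (_ - _).
  transitivity
    (Complex 0 (alpha x i k j * Num.sg (h k - h j)) * (X i k * Y k j)).
    by rewrite cE; ring.
  by rewrite e1 cE; ring.
transitivity (Complex 0 (alpha x j k i * Num.sg (h i - h k)) * (Y i k * X k j)).
  by rewrite cE; ring.
by rewrite e2 cE; ring.
Qed.

Lemma linear_metric_kahler : kahler x.
Proof.
have x_gt0 := linear_metric.
have pJ := in_p_cpx_struct; exists cpx_struct; split; last first.
  move=> X Y pX pY; split; last first.
    by rewrite !LCE ?cpx_struct_nomizu //; apply: pJ.
  rewrite !tformE //; try exact: pJ.
  congr (- _ *+ _); apply: eq_bigr => i _; apply: eq_bigr => j _.
  case: (eqVneq i j) => [->|i_j]; first by rewrite sxx !mul0r.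
  rewrite /redot !mxE -[h j - _]opprB sgrN; congr (_ * _).
  rewrite -[RHS]mul1r -(sgB_sqr i_j); case: (X i j) => ? ?.
  by case: (Y j i) => ? ? /=; ring.
split=> // [r X Y pX pY|X pX|a X [/diag_mxP[d ->] _ _] pX].
- by apply/matrixP => i j; rewrite !mxE; ring.
- apply/matrixP => i j; rewrite !mxE.
  case: (eqVneq i j) => [->|i_j]; first by rewrite !in_p_diag // !mulr0 oppr0.
  rewrite mulrA -[RHS]mulN1r; congr (_ * _).
  by congr Complex; rewrite /= ?mulr0 ?mul0r ?sgB_sqr //; ring.
(* Conjugation by a diagonal matrix scales each entry, as [cpx_struct] does, so the two commute. *)
- have adjE : adj (diag_mx d) = diag_mx (map_mx (fun z => conjc z) d).
    apply/matrixP => i j; rewrite !mxE eq_sym.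
    by case: eqP => [->|_]; rewrite ?mulr1n ?mulr0n ?conjc0.
  rewrite adjE !mul_diag_mx !mul_mx_diag.
  by apply/matrixP => i j; rewrite !mxE; ring.
Qed.

End LinearMetric.

(** * The metric gK on F(5) *)

Section FlagF5.
Variable R : realType.
Local Notation ord := (@inord 4).

(** Five consecutive integers: up to a permutation of the indices, gK is |i - j|. *)
Definition height (i : 'I_5) : R := nth 0 [:: 0; 1; -1; 2; -2] i.

(** Indexed by natural numbers so that the entries compute; outside the table the value is 0. *)
Definition gKtab (i j : nat) : R :=
  nth 0 (nth [::] [:: [:: 0; 1; 1; 2; 2]; [:: 1; 0; 2; 1; 3];
    [:: 1; 2; 0; 3; 1]; [:: 2; 1; 3; 0; 4]; [:: 2; 3; 1; 4; 0]] i) j.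

Lemma sx_gK i j : sx (gK R) i j = gKtab i j.
Proof.
case: (eqVneq i j) => [->|].
  by rewrite sxx; case: j => [[|[|[|[|[|]]]]]].
apply: (sxP (P := fun i j r => r = gKtab i j)) => [{}i {}j r ->|].
  by case: i => [[|[|[|[|[|]]]]]] //; case: j => [[|[|[|[|[|]]]]]].
case=> [[[a lt_a] [b lt_b]] /= lt_ab]; rewrite ffunE /=.
by move: a b lt_a lt_b lt_ab => [|[|[|[|[|]]]]] // [|[|[|[|[|]]]]].
Qed.

Lemma sx_gK_height i j : sx (gK R) i j = `|height i - height j|.
Proof.
rewrite sx_gK /height; case: i => [[|[|[|[|[|]]]]] //] lt_i;
  case: j => [[|[|[|[|[|]]]]] //] lt_j; rewrite /gKtab /=;
  by [rewrite ger0_norm; lra | rewrite ler0_norm; lra].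
Qed.

Lemma height_inj : injective height.
Proof.
move=> [[|[|[|[|[|]]]]] //] lt_i [[|[|[|[|[|]]]]] //] lt_j;
  rewrite /height /= => e; apply: val_inj => //=; exfalso; lra.
Qed.

Lemma ric_coef_gK i j : i != j -> ric_coef (gK R) i j = sx (gK R) i j.
Proof.
rewrite /ric_coef !sx_gK; under eq_bigr do rewrite !sx_gK.
rewrite !big_ord_recl big_ord0; case: i => [[|[|[|[|[|]]]]] //] lt_i;
  case: j => [[|[|[|[|[|]]]]] //] lt_j //= _; rewrite /gKtab /=;
  rewrite !(mulr0, mul0r, invr0); lra.
Qed.

Lemma gK_metric : is_metric (gK R).
Proof. exact: linear_metric height_inj sx_gK_height. Qed.

(** * The Hessian at positive multiples of gK *)

Section Scaled.
Variable c : R.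
Hypothesis c_gt0 : 0 < c.
Local Notation x := (c *: gK R).
Implicit Types S T : invtensor R 5.

Lemma scaled_gK_metric : is_metric x.
Proof. exact/is_metricZ/gK_metric. Qed.

Lemma scaled_gK_einstein : einstein x.
Proof.
(* [ric_coef] is invariant under scaling and equals m_ij at gK, which forces rho * 5 * c = 1. *)
apply: (einstein_ric_coef (rho := (5 * c)^-1)) scaled_gK_metric _ => i j i_j.
rewrite ric_coefZ ?gt_eqF // ric_coef_gK // sxZ.
by field; rewrite gt_eqF.
Qed.

Definition lv T (i j : nat) : R := logvar x T (ord i) (ord j).

Lemma logvar_lv T (i j : 'I_5) : logvar x T i j = lv T i j.
Proof. by rewrite /lv !inord_val. Qed.

Lemma lvC T i j : lv T i j = lv T j i.
Proof. by rewrite /lv /logvar sxC [sx x _ _]sxC. Qed.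

Lemma lv_diag T i : lv T i i = 0.
Proof. by rewrite /lv /logvar sxx mul0r. Qed.

(* 60 times the Hessian at gK, in logarithmic variations. *)
Definition hessform (s t : nat -> nat -> R) : R :=
  (s 0 1)%N * (10 * (t 0 1)%N - 6 * (t 0 2)%N + 12 * (t 0 3)%N - 4 * (t 0 4)%N
      + 12 * (t 1 2)%N - 6 * (t 1 3)%N + 6 * (t 1 4)%N)
  + (s 0 2)%N * (- 6 * (t 0 1)%N + 10 * (t 0 2)%N - 4 * (t 0 3)%N
      + 12 * (t 0 4)%N + 12 * (t 1 2)%N + 6 * (t 2 3)%N - 6 * (t 2 4)%N)
  + (s 0 3)%N * (12 * (t 0 1)%N - 4 * (t 0 2)%N - 11 * (t 0 3)%N - 3 * (t 0 4)%N
      + 12 * (t 1 3)%N + 12 * (t 2 3)%N + 6 * (t 3 4)%N)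
  + (s 0 4)%N * (- 4 * (t 0 1)%N + 12 * (t 0 2)%N - 3 * (t 0 3)%N
      - 11 * (t 0 4)%N + 12 * (t 1 4)%N + 12 * (t 2 4)%N + 6 * (t 3 4)%N)
  + (s 1 2)%N * (12 * (t 0 1)%N + 12 * (t 0 2)%N - 16 * (t 1 2)%N
      - 4 * (t 1 3)%N + 12 * (t 1 4)%N + 12 * (t 2 3)%N - 4 * (t 2 4)%N)
  + (s 1 3)%N * (- 6 * (t 0 1)%N + 12 * (t 0 3)%N - 4 * (t 1 2)%N
      + 15 * (t 1 3)%N - 3 * (t 1 4)%N + 6 * (t 2 3)%N + 4 * (t 3 4)%N)
  + (s 1 4)%N * (6 * (t 0 1)%N + 12 * (t 0 4)%N + 12 * (t 1 2)%N - 3 * (t 1 3)%N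
      - 21 * (t 1 4)%N + 6 * (t 2 4)%N + 12 * (t 3 4)%N)
  + (s 2 3)%N * (6 * (t 0 2)%N + 12 * (t 0 3)%N + 12 * (t 1 2)%N + 6 * (t 1 3)%N
      - 21 * (t 2 3)%N - 3 * (t 2 4)%N + 12 * (t 3 4)%N)
  + (s 2 4)%N * (- 6 * (t 0 2)%N + 12 * (t 0 4)%N - 4 * (t 1 2)%N
      + 6 * (t 1 4)%N - 3 * (t 2 3)%N + 15 * (t 2 4)%N + 4 * (t 3 4)%N)
  + (s 3 4)%N * (6 * (t 0 3)%N + 6 * (t 0 4)%N + 4 * (t 1 3)%N + 12 * (t 1 4)%N
      + 12 * (t 2 3)%N + 4 * (t 2 4)%N - 20 * (t 3 4)%N).

Lemma sum2_5 (F : nat -> nat -> R) :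
  (forall i, F i i = 0) -> (forall i j, F i j = F j i) ->
  \sum_(i < 5) \sum_(j < 5) F i j
  = 2 * ((F 0 1)%N + (F 0 2)%N + (F 0 3)%N + (F 0 4)%N + (F 1 2)%N
         + (F 1 3)%N + (F 1 4)%N + (F 2 3)%N + (F 2 4)%N + (F 3 4)%N).
Proof.
move=> F0 FC; rewrite !big_ord_recl !big_ord0 /= /bump /= !F0.
rewrite (FC 1 0)%N (FC 2 0)%N (FC 3 0)%N (FC 4 0)%N (FC 2 1)%N (FC 3 1)%N.
by rewrite (FC 4 1)%N (FC 3 2)%N (FC 4 2)%N (FC 4 3)%N; ring.
Qed.

(** The symmetry and the two vanishing conditions reduce 125 terms to ten pairs i < j with three
    values of k each. *)
Lemma sum3_5 (F : nat -> nat -> nat -> R) :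
  (forall i k, F i i k = 0) -> (forall i k, F i k i = 0) ->
  (forall i j k, F i j k = F j i k) ->
  \sum_(i < 5) \sum_(j < 5) \sum_(k < 5) F i j k
  = 2 * ((F 0 1 2)%N + (F 0 1 3)%N + (F 0 1 4)%N + (F 0 2 1)%N + (F 0 2 3)%N
         + (F 0 2 4)%N + (F 0 3 1)%N + (F 0 3 2)%N + (F 0 3 4)%N + (F 0 4 1)%N
         + (F 0 4 2)%N + (F 0 4 3)%N + (F 1 2 0)%N + (F 1 2 3)%N + (F 1 2 4)%N
         + (F 1 3 0)%N + (F 1 3 2)%N + (F 1 3 4)%N + (F 1 4 0)%N + (F 1 4 2)%N
         + (F 1 4 3)%N + (F 2 3 0)%N + (F 2 3 1)%N + (F 2 3 4)%N + (F 2 4 0)%N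
         + (F 2 4 1)%N + (F 2 4 3)%N + (F 3 4 0)%N + (F 3 4 1)%N + (F 3 4 2)%N).
Proof.
move=> F0 F1 FC.
rewrite (sum2_5 (F := fun i j => \sum_(k < 5) F i j k)) => [|i|i j];
  last 2 first.
- by apply: big1 => k _; rewrite F0.
- by apply: eq_bigr => k _; rewrite FC.
have F2 i k : F k i i = 0 by rewrite FC F1.
by rewrite !big_ord_recl !big_ord0 /= /bump /= !(F1, F2); ring.
Qed.

Lemma gKtabC i j : gKtab i j = gKtab j i.
Proof.
have nth0 k : nth [::] [::] k = [::] :> seq R by case: k.
by case: i => [|[|[|[|[|i]]]]]; case: j => [|[|[|[|[|j]]]]];
  rewrite /gKtab /= ?nth_nil.
Qed.

Lemma gKtab_diag i : gKtab i i = 0.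
Proof. by case: i => [|[|[|[|[|i]]]]]; rewrite /gKtab /= ?nth_nil. Qed.

(** In logarithmic variations the Hessian has degree -1 in the metric, which yields the inverse of
    c; the factor 60 clears denominators. *)
Lemma scaled_gK_hess S T :
  scal_hess x S T = (60 * c)^-1 * hessform (lv S) (lv T).
Proof.
rewrite (scal_hessE scaled_gK_metric).
have c_neq0 : c != 0 by rewrite gt_eqF.
have sxE' (i j : 'I_5) : sx x i j = c * gKtab i j by rewrite sxZ sx_gK.
pose s := lv S; pose t := lv T.
rewrite (eq_bigr (fun i : 'I_5 => \sum_(j < 5)
  c^-1 * (s i j * t i j / gKtab i j))); last first.
  move=> i _; apply: eq_bigr => j _.
  rewrite sxE' !logvar_lv invfM -/s -/t; ring.
rewrite (eq_sum3 (G := fun i j k : 'I_5 => c^-1 *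
   (gKtab i j / (gKtab i k * gKtab j k) * ((s i j - s i k - s j k) *
     (t i j - t i k - t j k))))); last first.
  move=> i j k; rewrite !sxE' /logvar3 !logvar_lv -/s -/t !invfM.
  have -> : c * gKtab i j * (c^-1 * (gKtab i k)^-1 * (c^-1 * (gKtab j k)^-1))
    = c * c^-1 * (c^-1 * (gKtab i j * ((gKtab i k)^-1 * (gKtab j k)^-1))).
    by ring.
  by rewrite divff // mul1r; ring.
rewrite (sum2_5 (F := fun i j => c^-1 * (s i j * t i j / gKtab i j)));
  first last.
- by move=> i j; rewrite gKtabC /s /t (lvC S) (lvC T).
- by move=> i; rewrite gKtab_diag invr0 !mulr0.
rewrite (sum3_5 (F := fun i j k => c^-1 *
   (gKtab i j / (gKtab i k * gKtab j k) * ((s i j - s i k - s j k) *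
     (t i j - t i k - t j k))))); first last.
- move=> i j k; rewrite (gKtabC i j) /s /t (lvC S i j) (lvC T i j).
  by rewrite [gKtab i k * _]mulrC; ring.
(* For k = i a denominator is zero and the convention 1/0 = 0 applies. *)
- by move=> i k; rewrite gKtab_diag mul0r invr0 mulr0 mul0r mulr0.
- by move=> i k; rewrite gKtab_diag !mul0r mulr0.
rewrite /s /t (lvC S 2 1) (lvC S 3 1) (lvC S 4 1) (lvC S 3 2) (lvC S 4 2).
rewrite (lvC S 4 3) (lvC T 2 1) (lvC T 3 1) (lvC T 4 1) (lvC T 3 2) (lvC T 4 2).
rewrite (lvC T 4 3) (lvC S 1 0) (lvC S 2 0) (lvC S 3 0) (lvC S 4 0).
rewrite (lvC T 1 0) (lvC T 2 0) (lvC T 3 0) (lvC T 4 0).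
by rewrite /gKtab /= /hessform; field.
Qed.

End Scaled.

End FlagF5.

(** * Non-degeneracy, instability and coindex at multiples of gK *)

Section ScaledIndex.
Variables (R : realType) (c : R).
Hypothesis c_gt0 : 0 < c.
Local Notation ord := (@inord 4).
Local Notation x := (c *: gK R).
Local Notation lv := (lv c).
Implicit Types S T : invtensor R 5.

Lemma scaled_gK_TT T : in_TT x T <->
  lv T 0 1 + lv T 0 2 + lv T 0 3 + lv T 0 4 + lv T 1 2 + lv T 1 3 + lv T 1 4
  + lv T 2 3 + lv T 2 4 + lv T 3 4 = 0.
Proof.
rewrite (in_TTE (scaled_gK_metric c_gt0)).
rewrite (eq_bigr (fun i : 'I_5 => \sum_(j < 5) lv T i j)); last first.
  by move=> i _; apply: eq_bigr => j _; rewrite logvar_lv.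
rewrite (sum2_5 (lv_diag c T) (lvC c T)); split=> [|->]; last by rewrite mulr0.
by move=> e; lra.
Qed.

Lemma lv_eq0 T : (forall i j, (i < j < 5)%N -> lv T i j = 0) -> T = 0.
Proof.
move=> T0; apply/ffunP => p; rewrite ffunE -sxE.
have x_p : sx x (val p).1 (val p).2 != 0.
  by rewrite gt_eqF // sx_gt0 ?ordpair_neq //; apply: scaled_gK_metric.
have := T0 (val p).1 (val p).2; rewrite -logvar_lv (valP p) ltn_ord => /(_ isT).
by move/eqP; rewrite /logvar mulf_eq0 invr_eq0 (negPf x_p) orbF => /eqP.
Qed.

Definition of_lv (v : nat -> nat -> R) : invtensor R 5 :=
  [ffun p : ordpair 5 => (x p : R) * v (val p).1 (val p).2].

Lemma lv_of_lv v i j : (i < j < 5)%N -> lv (of_lv v) i j = v i j.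
Proof.
move=> /andP[lt_ij lt_j]; have lt_i := ltn_trans lt_ij lt_j.
pose p : ordpair 5 := Sub (Ordinal lt_i, Ordinal lt_j) lt_ij.
have -> : lv (of_lv v) i j = logvar x (of_lv v) (val p).1 (val p).2.
  by rewrite logvar_lv.
have /gt_eqF/negbT x_p := scaled_gK_metric c_gt0 p.
by rewrite /logvar !sxE ffunE mulrAC divff ?mul1r.
Qed.

Definition table (a01 a02 a03 a04 a12 a13 a14 a23 a24 a34 : R) (i j : nat) :
    R :=
  nth 0 (nth [::] [:: [:: 0; a01; a02; a03; a04]; [:: 0; 0; a12; a13; a14];
    [:: 0; 0; 0; a23; a24]; [:: 0; 0; 0; 0; a34]] i) j.

Lemma scaled_gK_nondegenerate : G_nondegenerate x.
Proof.
split=> [|S]; first exact: scaled_gK_einstein.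
rewrite scaled_gK_TT => S_tr S_orth.
have test a01 a02 a03 a04 a12 a13 a14 a23 a24 a34 :
    a01 + a02 + a03 + a04 + a12 + a13 + a14 + a23 + a24 + a34 = 0 ->
    hessform (lv S) (table a01 a02 a03 a04 a12 a13 a14 a23 a24 a34) = 0.
  move=> a_tr; pose T := of_lv (table a01 a02 a03 a04 a12 a13 a14 a23 a24 a34).
  have := S_orth T; rewrite scaled_gK_TT scaled_gK_hess //.
  rewrite /hessform /T !lv_of_lv // => /(_ a_tr)/eqP.
  have /negPf k_neq0 : (60 * c)^-1 != 0.
    by rewrite invr_neq0 // gt_eqF ?mulr_gt0.
  by rewrite mulf_eq0 k_neq0 => /eqP.
(* One variation raised by 1 and the (3,4) one lowered by 1: these nine tests form a basis of the
   trace-free hyperplane. *)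
have {test} := (test 1 0 0 0 0 0 0 0 0 (-1), test 0 1 0 0 0 0 0 0 0 (-1),
  test 0 0 1 0 0 0 0 0 0 (-1), test 0 0 0 1 0 0 0 0 0 (-1),
  test 0 0 0 0 1 0 0 0 0 (-1), test 0 0 0 0 0 1 0 0 0 (-1),
  test 0 0 0 0 0 0 1 0 0 (-1), test 0 0 0 0 0 0 0 1 0 (-1),
  test 0 0 0 0 0 0 0 0 1 (-1)).
rewrite /hessform /table /= => -[[[[[[[[e1 e2] e3] e4] e5] e6] e7] e8] e9].
have {}e1 := e1 ltac:(ring); have {}e2 := e2 ltac:(ring).
have {}e3 := e3 ltac:(ring); have {}e4 := e4 ltac:(ring).
have {}e5 := e5 ltac:(ring); have {}e6 := e6 ltac:(ring).
have {}e7 := e7 ltac:(ring); have {}e8 := e8 ltac:(ring).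
have {}e9 := e9 ltac:(ring).
(* The nine equations and the trace condition are a linear system in ten unknowns whose only
   solution is 0. *)
apply: lv_eq0 => -[|[|[|[|[|i]]]]] [|[|[|[|[|j]]]]] //=;
  rewrite ?andbF // => _; move: S_tr e1 e2 e3 e4 e5 e6 e7 e8 e9; clear; lra.
Qed.

(* The reflection h -> - h exchanges the indices 1, 2 and 3, 4. The first two
   parameters span odd variations, the third an even one. *)
Definition coindex_vec (u : 'rV[R]_3) : invtensor R 5 :=
  let a := u 0 (@inord 2 0) in let b := u 0 (@inord 2 1) in
  let d := u 0 (@inord 2 2) in
  of_lv (table (a + d) (d - a) 0 0 0 (b - d) 0 0 (- b - d) 0).

Lemma coindex_vec_linear : linear coindex_vec.
Proof.
move=> r u v; apply/ffunP => p; rewrite !ffunE /= !mxE.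
case: p => [[[i lt_i] [j lt_j]] lt_ij] /=; rewrite /GRing.scale /=.
by move: i j {lt_i lt_j lt_ij} => [|[|[|[|[|i]]]]] [|[|[|[|[|j]]]]];
  rewrite /table /= ?nth_nil; ring.
Qed.

HB.instance Definition _ := GRing.isLinear.Build R 'rV[R]_3 (invtensor R 5)
  *:%R coindex_vec coindex_vec_linear.

Lemma coindex_vec_TT u : in_TT x (coindex_vec u).
Proof. by rewrite scaled_gK_TT !lv_of_lv // /table /=; ring. Qed.

Lemma coindex_vec_hess u : u != 0 ->
  0 < scal_hess x (coindex_vec u) (coindex_vec u).
Proof.
move=> u_neq0; rewrite scaled_gK_hess // /hessform !lv_of_lv // /table /=.
set a := u 0 (inord 0); set b := u 0 (inord 1); set d := u 0 (inord 2).
rewrite pmulr_rgt0; last by rewrite invr_gt0 mulr_gt0.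
(* Completing the square gives 32 (a - 3/8 b)^2 + 51/2 b^2 + 62 d^2. *)
rewrite (_ : _ + _ = 32 * a ^+ 2 - 24 * a * b + 30 * b ^+ 2 + 62 * d ^+ 2);
  last ring.
rewrite lt_neqAle; apply/andP; split; last first.
  have := (sqr_ge0 (a - 3 / 8 * b), sqr_ge0 b, sqr_ge0 d).
  by move=> -[[? ?] ?]; lra.
apply: contra u_neq0 => /eqP e; apply/eqP/rowP => k; rewrite mxE.
have sqs := (sqr_ge0 (a - 3 / 8 * b), sqr_ge0 b, sqr_ge0 d).
have /eqP : (a - 3 / 8 * b) ^+ 2 = 0 by case: sqs => -[? ?] ?; lra.
have /eqP : b ^+ 2 = 0 by case: sqs => -[? ?] ?; lra.
have /eqP : d ^+ 2 = 0 by case: sqs => -[? ?] ?; lra.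
rewrite !sqrf_eq0 => /eqP d0 /eqP b0; rewrite b0 mulr0 subr0 => /eqP a0.
by rewrite -[k]inord_val; case: k => [[|[|[|]]]].
Qed.

(* The first two forms are odd and the third even under that reflection. On
   their common trace-free kernel, completing squares separately in the odd and
   even variables exhibits the Hessian as minus a sum of squares. *)
Definition neg_forms T : 'rV[R]_3 := \row_k
  nth 0 [:: lv T 0 1 - lv T 0 2 + lv T 0 3 - lv T 0 4;
            lv T 1 3 - lv T 2 4 - lv T 1 4 + lv T 2 3;
            lv T 0 3 + lv T 0 4 + lv T 1 3 + lv T 2 4] k.

Lemma neg_forms_linear : linear neg_forms.
Proof.
move=> r S T; apply/rowP => k; rewrite !mxE.
have lvD i j : lv (r *: S + T) i j = r * lv S i j + lv T i j.
  by rewrite -[T in LHS]scale1r /lv logvar_linear mul1r.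
by case: k => [[|[|[|]]]] //= ?; rewrite !lvD; ring.
Qed.

HB.instance Definition _ := GRing.isLinear.Build R (invtensor R 5) 'rV[R]_3
  *:%R neg_forms neg_forms_linear.

(** Three linear conditions thus exclude every positive direction, which bounds the coindex from
    above. *)
Lemma neg_forms_hess T : in_TT x T -> neg_forms T = 0 -> scal_hess x T T <= 0.
Proof.
rewrite scaled_gK_TT => T_tr /rowP T0.
have := (T0 (@inord 2 0), T0 (@inord 2 1), T0 (@inord 2 2)).
rewrite !mxE !inordK //= => -[[f1 f2] f3].
rewrite scaled_gK_hess // pmulr_rle0; last by rewrite invr_gt0 mulr_gt0.
have sq_ge0 (r y : R) : 0 <= r -> 0 <= r * y ^+ 2.
  by move=> r_ge0; rewrite mulr_ge0 ?sqr_ge0.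
have sos (y1 y2 y3 y4 y5 y6 : R) : 0 <= 48 * y1 ^+ 2 + 48 * y2 ^+ 2
    + 36 * y3 ^+ 2 + 410 / 9 * y4 ^+ 2 + 288 / 5 * y5 ^+ 2 + 528 / 41 * y6 ^+ 2.
  by rewrite !addr_ge0 ?sq_ge0 ?divr_ge0 ?ler0n.
(* Under the reflection [al] and [be] are odd, while [e1], [e3], [e4] and the (1,2) variation are
   even; these six are coordinates on the trace-free kernel. *)
pose al := (lv T 0 3 - lv T 0 4) / 2; pose be := (lv T 1 4 - lv T 2 3) / 2.
pose e1 := (lv T 0 1 + lv T 0 2) / 2; pose e3 := (lv T 1 3 + lv T 2 4) / 2.
pose e4 := (lv T 1 4 + lv T 2 3) / 2.
suff -> : hessform (lv T) (lv T) = - (48 * al ^+ 2 + 48 * be ^+ 2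
    + 36 * (lv T 1 2 + e3 / 9 + 4 / 9 * e1 + 10 / 9 * e4) ^+ 2
    + 410 / 9 * (e3 + 2 / 5 * e1 + 5 / 41 * e4) ^+ 2
    + 288 / 5 * (e1 + 5 / 3 * e4) ^+ 2 + 528 / 41 * e4 ^+ 2).
  by rewrite oppr_le0; apply: sos.
(* The three forms and the trace are solved for four variations, leaving a polynomial identity in
   the other six. *)
have h02 : lv T 0 2 = lv T 0 1 + lv T 0 3 - lv T 0 4 by lra.
have h24 : lv T 2 4 = - lv T 0 3 - lv T 0 4 - lv T 1 3 by lra.
have h23 : lv T 2 3 = lv T 1 4 - lv T 1 3 + lv T 2 4 by lra.
have h34 : lv T 3 4 = - (lv T 0 1 + lv T 0 2 + lv T 0 3 + lv T 0 4 + lv T 1 2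
  + lv T 1 3 + lv T 1 4 + lv T 2 3 + lv T 2 4) by lra.
by rewrite /hessform /al /be /e1 /e3 /e4 h34 h23 h24 h02; field.
Qed.

Lemma scaled_gK_unstable : G_unstable x.
Proof.
split; first exact: scaled_gK_einstein.
exists (coindex_vec (const_mx 1)); first exact: coindex_vec_TT.
apply: coindex_vec_hess; apply/eqP => /matrixP/(_ 0 0).
by rewrite !mxE => /eqP; rewrite oner_eq0.
Qed.

(** The image of [coindex_vec] gives the lower bound; [neg_forms] is injective on every positive
    subspace, which gives the upper bound. *)
Lemma scaled_gK_coindex : coindex_eq 3 x.
Proof.
split; first exact: scaled_gK_einstein.
- exists (limg (linfun coindex_vec)).
    split=> T /memv_imgP[u _ ->]; rewrite lfunE; first exact: coindex_vec_TT.
    move=> fu_neq0; apply: coindex_vec_hess; apply: contra fu_neq0 => /eqP->.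
    by rewrite linear0.
  rewrite limg_dim_eq ?dimvf /dim /= ?mul1n //; apply/eqP.
  rewrite -subv0; apply/subvP => u; rewrite memv_cap memv_ker memv0 lfunE.
  (* A nonzero kernel vector would give the zero tensor a positive Hessian. *)
  move=> /andP[_ /eqP fu0]; apply: contraT => /coindex_vec_hess.
  have lv0 i j : lv 0 i j = 0.
    by rewrite /lv /logvar -(scale0r (0 : invtensor R 5)) sxZ !mul0r.
  by rewrite fu0 scaled_gK_hess // /hessform !lv0 !mul0r !addr0 mulr0 ltxx.
- move=> V [V_TT V_pos]; have <- : \dim (linfun neg_forms @: V) = \dim V.
    apply: limg_dim_eq; apply/eqP; rewrite -subv0; apply/subvP => T.
    rewrite memv_cap memv_ker memv0 lfunE => /andP[VT /eqP T0].
    (* A nonzero T in V killed by [neg_forms] would have a Hessian both positive and at most 0. *)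
    apply: contraT => /(V_pos _ VT); rewrite ltNge neg_forms_hess //.
    exact: V_TT.
  by apply: leq_trans (dimvS (subvf _)) _; rewrite dimvf /dim /= mul1n.
Qed.

End ScaledIndex.

Lemma card_pidx5 : (0 < #|{: pidx 5}|)%N.
Proof.
have lt01 : ((ord0 : 'I_5) < (lift ord0 ord0 : 'I_5))%N by [].
apply/card_gt0P.
by exists (Sub (ord0 : 'I_5, lift ord0 ord0 : 'I_5) lt01, true).
Qed.

(** The stability claims are proved at every positive multiple of gK, and the reference volume v0
    only selects one of these multiples. *)
Theorem proposition8p4 (R : realType) (v0 : R) (hv0 : 0 < v0) :
  is_metric (gK R) /\ kahler (gK R) /\ einstein (gK R) /\
  at_unit_volume v0 (@G_nondegenerate R 5) (gK R) /\
  at_unit_volume v0 (@G_unstable R 5) (gK R) /\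
  at_unit_volume v0 (@coindex_eq R 5 3) (gK R).
Proof.
have x_gt0 := gK_metric R; have N_gt0 := card_pidx5.
split=> //; split.
  exact: linear_metric_kahler (@height_inj R) (@sx_gK_height R).
split.
  by rewrite -[gK R]scale1r; apply: scaled_gK_einstein.
split; first by apply: at_unit_volumeP => // c; apply: scaled_gK_nondegenerate.
split; first by apply: at_unit_volumeP => // c; apply: scaled_gK_unstable.
by apply: at_unit_volumeP => // c; apply: scaled_gK_coindex.
Qed.
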